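(* Let $n\ge1$. For almost every $A\in\mathbb{C}^{n\times n}$, over the set of normal matrices $X\in\mathbb{C}^{n\times n}$ there are finitely many local minimizers of the function $X\mapsto\|A-X\|_F^2$. Moreover, every such local minimizer $N_0$ has distinct eigenvalues (i.e. $n$ pairwise distinct eigenvalues), and corresponds to precisely $n!$ local minimizers of $f_A$ on $\mathcal{F}_n$, i.e. there are exactly $n!$ local minimizers $[Q]\in\mathcal{F}_n$ of $f_A$ with $Q\,\mathrm{diag}(Q^*AQ)\,Q^*=N_0$.
   Context: A matrix $X\in\mathbb{C}^{n\times n}$ is normal if $XX^*=X^*X$. $\|X\|_F^2=\mathrm{trace}(X^*X)$ is the squared Frobenius norm. $\mathrm{diag}(X)$ denotes the diagonal matrix whose diagonal entries coincide with those of $X$, and $\mathcal{N}(X):=X-\mathrm{diag}(X)$. $U(n)$ is the group of $n\times n$ unitary matrices and $\mathcal{F}_n:=U(n)/U(1)^n$ (the flag manifold) is its quotient by right multiplication by diagonal unitary matrices; $[Q]$ is the class of $Q$. The function $f_A(Q):=\|\mathcal{N}(Q^*AQ)\|_F^2$ on $U(n)$ and the map $N(Q):=Q\,\mathrm{diag}(Q^*AQ)\,Q^*$ depend only on $[Q]$, hence are well defined on $\mathcal{F}_n$. ''Local minimizer over the set of normal matrices'' means local minimizer of the restriction to that set with the topology induced from $\mathbb{C}^{n\times n}$. ''Almost every'' refers to Lebesgue measure on $\mathbb{C}^{n\times n}\cong\mathbb{R}^{2n^2}$. *)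

(* Defs.v *)
From HB Require Import structures.
From mathcomp Require Import all_boot all_order all_algebra.
From mathcomp Require Import all_classical all_reals all_analysis.
From mathcomp Require Import complex.

Set Implicit Arguments.
Unset Strict Implicit.
Unset Printing Implicit Defensive.

Import Order.TTheory GRing.Theory Num.Theory.
Import numFieldNormedType.Exports.
Import ComplexField.

Local Open Scope classical_set_scope.
Local Open Scope ring_scope.
Local Open Scope sesquilinear_scope.
Local Open Scope quotient_scope.

(* R[i] bundled as a numClosedFieldType: MathComp-Analysis attaches the norm
   topology to that structure, not to the type constructor R[i]. *)
Definition Cfield (R : realType) : numClosedFieldType := R[i].

Section LocalMinimizer.
Context {T : topologicalType} {d : Order.disp_t} {K : porderType d}.

Definition local_minimizer (f : T -> K) (x : T) : Prop :=
  \forall y \near x, (f x <= f y)%O.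

(* Local minimizer of the restriction of f to D, for the topology induced
   on D. *)
Definition local_minimizer_on (D : set T) (f : T -> K) (x : T) : Prop :=
  D x /\ \forall y \near within D (nbhs x), (f x <= f y)%O.

End LocalMinimizer.

Section Matrices.
Context {R : realType} {n : nat}.
Local Notation C := (Cfield R).
Implicit Types X A D E : 'M[C]_n.

(* The trace is a nonnegative real, see frobenius2E; taking its real part only
   changes its type from C to R. *)
Definition frobenius2 X : R := complex.Re (\tr (X ^t* *m X)).

Definition diag_part X : 'M[C]_n := diag_mx (\row_i X i i).

Definition offdiag X : 'M[C]_n := X - diag_part X.

Definition normal_matrices : set 'M[C]_n := [set X | X \is normalmx].

Definition has_distinct_eigenvalues X : Prop :=
  exists s : n.-tuple C, uniq s /\ all (eigenvalue X) s.

Definition unitary_group : set 'M[C]_n := [set Q | Q \is unitarymx].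

Implicit Types P Q S : unitary_group.

Definition f_unitary A (Q : unitary_group) : R :=
  frobenius2 (offdiag ((\val Q) ^t* *m A *m \val Q)).

Definition N_unitary A (Q : unitary_group) : 'M[C]_n :=
  \val Q *m diag_part ((\val Q) ^t* *m A *m \val Q) *m (\val Q) ^t*.

Lemma frobenius2E X : ((frobenius2 X)%:C)%C = \tr (X ^t* *m X) :> C.
Proof.
have tr_ge0 : 0 <= \tr (X ^t* *m X).
  rewrite /mxtrace sumr_ge0// => i _; rewrite mxE sumr_ge0// => j _.
  by rewrite !mxE mulrC mul_conjC_ge0.
exact/RRe_real/ger0_real.
Qed.

Definition diag_unitary (D : 'M[C]_n) : Prop :=
  is_diag_mx D /\ D \is unitarymx.

Definition flag_rel (P Q : unitary_group) : bool :=
  `[< exists2 D : 'M[C]_n, diag_unitary D & \val Q = \val P *m D >].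

Lemma diag_unitary1 : diag_unitary 1%:M.
Proof.
split; first exact: scalar_mx_is_diag.
by apply/unitarymxP; rewrite mul1mx trmx1 map_mx1.
Qed.

Lemma diag_unitaryM D E : diag_unitary D -> diag_unitary E ->
  diag_unitary (D *m E).
Proof.
move=> [/is_diag_mxP dD uD] [/is_diag_mxP dE uE].
split; last exact: mul_unitarymx.
apply/is_diag_mxP => i j ij; rewrite mxE big1// => k _.
have [ik|ik] := eqVneq (i : nat) k; last by rewrite dD ?mul0r.
by rewrite dE ?mulr0// -ik.
Qed.

Lemma diag_unitaryV D : diag_unitary D -> diag_unitary (D ^t*).
Proof.
move=> [/is_diag_mxP dD uD]; split.
  by apply/is_diag_mxP => i j ij; rewrite !mxE dD ?conjC0// eq_sym.
by rewrite conjC_unitary trmx_unitary.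
Qed.

Lemma flag_relP (P Q : unitary_group) :
  reflect (exists2 D : 'M[C]_n, diag_unitary D & \val Q = \val P *m D)
          (flag_rel P Q).
Proof. exact: asboolP. Qed.

Lemma flag_rel_refl : reflexive flag_rel.
Proof.
by move=> P; apply/flag_relP; exists 1%:M; [exact: diag_unitary1|rewrite mulmx1].
Qed.

Lemma flag_rel_symW P Q : flag_rel P Q -> flag_rel Q P.
Proof.
move=> /flag_relP[D uD QE]; apply/flag_relP; exists (D ^t*).
  exact: diag_unitaryV.
by rewrite QE; case: uD => _ /unitarymxP DD; rewrite -mulmxA DD mulmx1.
Qed.

Lemma flag_rel_sym : symmetric flag_rel.
Proof. by move=> P Q; apply/idP/idP; exact: flag_rel_symW. Qed.

Lemma flag_rel_trans : transitive flag_rel.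
Proof.
move=> Q P S /flag_relP[D uD QE] /flag_relP[E uE SE]; apply/flag_relP.
by exists (D *m E); [exact: diag_unitaryM|rewrite SE QE mulmxA].
Qed.

Canonical flag_equiv :=
  EquivRel flag_rel flag_rel_refl flag_rel_sym flag_rel_trans.

Lemma diag_unitary_conj X D : diag_unitary D ->
  diag_part (D ^t* *m X *m D) = D ^t* *m diag_part X *m D.
Proof.
move=> [/is_diag_mxP dD _].
have DE : D = diag_mx (\row_i D i i).
  apply/matrixP => i j; rewrite !mxE; have [->|ij] := eqVneq i j => //=.
  by rewrite dD.
have DtE : D ^t* = diag_mx (\row_i (D i i)^*).
  apply/matrixP => i j; rewrite !mxE; have [->|ij] := eqVneq i j => //=.
  by rewrite dD ?conjC0// eq_sym.
rewrite DtE [in LHS]DE [in RHS]DE /diag_part -[RHS]mulmxA !mulmx_diag.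
congr diag_mx; apply/rowP => i.
by rewrite mxE mul_mx_diag mxE mul_diag_mx !mxE mulrA.
Qed.

Lemma flag_rel_conj A P Q D : \val Q = \val P *m D ->
  (\val Q) ^t* *m A *m \val Q = D ^t* *m ((\val P) ^t* *m A *m \val P) *m D.
Proof. by move=> ->; rewrite trmx_mul map_mxM !mulmxA. Qed.

Lemma f_unitary_flag A P Q : flag_rel P Q -> f_unitary A P = f_unitary A Q.
Proof.
move=> /flag_relP[D uD QE]; apply: (@complexI R).
rewrite /f_unitary !frobenius2E (flag_rel_conj A QE).
rewrite /offdiag (diag_unitary_conj _ uD) -mulmxBl -mulmxBr.
set X := _ - _; have [_ Du] := uD.
rewrite !trmx_mul !map_mxM trmxCK !mulmxA mulmxtVK//.
by rewrite [RHS]mxtrace_mulC !mulmxA [D *m _](unitarymxP Du) mul1mx.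
Qed.

Lemma N_unitary_flag A P Q : flag_rel P Q -> N_unitary A P = N_unitary A Q.
Proof.
move=> /flag_relP[D uD QE].
rewrite /N_unitary (flag_rel_conj A QE) (diag_unitary_conj _ uD) QE.
have [_ Du] := uD.
by rewrite trmx_mul map_mxM !mulmxA !mulmxtVK.
Qed.

End Matrices.

Definition flag_manifold (R : realType) (n : nat) : topologicalType :=
  quotient_topology {eq_quot (@flag_equiv R n)}.

Section Flag.
Context {R : realType} {n : nat}.
Local Notation C := (Cfield R).
Local Notation F := (flag_manifold R n).

Definition flag_class (Q : @unitary_group R n) : F :=
  \pi_(quotient_topology {eq_quot (@flag_equiv R n)}) Q.

Definition flag_repr (q : F) : @unitary_group R n :=
  repr (q : quotient_topology {eq_quot (@flag_equiv R n)}).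

Definition f_flag (A : 'M[C]_n) (q : F) : R := f_unitary A (flag_repr q).
Definition N_flag (A : 'M[C]_n) (q : F) : 'M[C]_n := N_unitary A (flag_repr q).

Lemma flag_reprK (q : F) : flag_class (flag_repr q) = q.
Proof. exact: (@reprK _ {eq_quot (@flag_equiv R n)}). Qed.

Lemma flag_classP (P Q : @unitary_group R n) :
  reflect (exists2 D : 'M[C]_n, diag_unitary D & \val Q = \val P *m D)
          (flag_class P == flag_class Q).
Proof.
apply: (iffP idP) => [/eqP|PQ]; first by move=> /eqmodP/flag_relP.
by apply/eqP/eqmodP/flag_relP.
Qed.

Lemma flag_class_repr (Q : @unitary_group R n) :
  flag_rel (flag_repr (flag_class Q)) Q.
Proof. by apply/flag_relP/flag_classP; rewrite flag_reprK. Qed.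

Lemma f_flagE A Q : f_flag A (flag_class Q) = f_unitary A Q.
Proof. exact/f_unitary_flag/flag_class_repr. Qed.

Lemma N_flagE A Q : N_flag A (flag_class Q) = N_unitary A Q.
Proof. exact/N_unitary_flag/flag_class_repr. Qed.

End Flag.

(* The library proves this only as a section-local fact, and its canonical
   instance is not found by unification. *)
Lemma sigma_finite_product (R : realType) (d1 d2 : measure_display)
    (T1 : measurableType d1) (T2 : measurableType d2)
    (m1 : {sigma_finite_measure set T1 -> \bar R})
    (m2 : {sigma_finite_measure set T2 -> \bar R}) :
  sigma_finite setT (m1 \x m2)%E.
Proof.
have /sigma_finiteP[F [TF ndF Foo]] := sigma_finiteT m1.
have /sigma_finiteP[G [TG ndG Goo]] := sigma_finiteT m2.
exists (fun i => F i `*` G i).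
  rewrite -setXTT TF TG predeqE => -[x y]; split.
    move=> [/= [i _ Fix] [j _ Gjy]]; exists (maxn i j) => //; split.
    - by move: x Fix; exact/subsetPset/ndF/leq_maxl.
    - by move: y Gjy; exact/subsetPset/ndG/leq_maxr.
  by move=> [i _ []/= ? ?]; split; exists i.
move=> k; have [? ?] := Foo k; have [? ?] := Goo k.
split; first exact: measurableX.
by rewrite product_measure1E// lte_mul_pinfty// ge0_fin_numE.
Qed.

Section ProductPower.
Context {R : realType} {d : measure_display} {T : measurableType d}.
Local Open Scope ereal_scope.

Section Cons.
Variable m : {sigma_finite_measure set T -> \bar R}.
Context {k : nat}.
Variable mu : {sigma_finite_measure set (k.-tuple T) -> \bar R}.

Definition cons_pair (p : T * k.-tuple T) : k.+1.-tuple T :=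
  [the k.+1.-tuple _ of p.1 :: p.2].

Lemma measurable_cons_pair : measurable_fun setT cons_pair.
Proof. exact: measurable_cons. Qed.

Definition product_cons : set (k.+1.-tuple T) -> \bar R :=
  pushforward (m \x mu) cons_pair.

Let mf := measurable_cons_pair.

Let product_cons0 : product_cons set0 = 0.
Proof. by rewrite /product_cons /pushforward preimage_set0 measure0. Qed.

Let product_cons_ge0 A : 0 <= product_cons A.
Proof. exact: measure_ge0. Qed.

Let product_cons_sigma_additive : semi_sigma_additive product_cons.
Proof.
move=> F mF tF mUF; rewrite /product_cons /pushforward preimage_bigcup.
apply: measure_semi_sigma_additive.
- by move=> i; rewrite -[X in measurable X]setTI; exact: mf.
- apply/trivIsetP => /= i j _ _ ij; rewrite -preimage_setI.
  by move/trivIsetP : tF => /(_ _ _ _ _ ij) ->//; rewrite preimage_set0.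
- by rewrite -preimage_bigcup -[X in measurable X]setTI; exact: mf.
Qed.

HB.instance Definition _ := isMeasure.Build _ _ _ product_cons
  product_cons0 product_cons_ge0 product_cons_sigma_additive.

Let product_cons_sigma_finite : sigma_finite setT product_cons.
Proof.
have [F TF mF] := sigma_finite_product m mu.
pose g (t : k.+1.-tuple T) := (tnth t ord0, [tuple of behead t]).
have mg : measurable_fun setT g.
  by apply: measurable_fun_pair; [exact: measurable_tnth|exact: measurable_behead].
have gK p : g (cons_pair p) = p.
  by case: p => x t; rewrite /g; congr pair; apply: val_inj.
exists (fun i => g @^-1` F i).
  by rewrite -preimage_bigcup -TF preimage_setT.
move=> i; have [mFi Fi] := mF i; split.
  by rewrite -[X in measurable X]setTI; exact: mg.
rewrite /product_cons /pushforward -comp_preimage.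
by rewrite (_ : g \o _ = id)//; exact/funext.
Qed.

HB.instance Definition _ := Measure_isSigmaFinite.Build _ _ _ product_cons
  product_cons_sigma_finite.

End Cons.

Fixpoint product_power (m : {sigma_finite_measure set T -> \bar R}) (k : nat) :
    {sigma_finite_measure set (k.-tuple T) -> \bar R} :=
  if k is k'.+1 then product_cons m (product_power m k')
  else \d_([tuple] : 0.-tuple T).

Lemma product_power_box (m : {sigma_finite_measure set T -> \bar R}) k
    (A : 'I_k -> set T) : (forall i, measurable (A i)) ->
  product_power m k [set t | forall i, A i (tnth t i)] =
  \prod_(i < k) m (A i).
Proof.
elim: k A => [|k IH] A mA.
  by rewrite big_ord0 /= diracE mem_set// => -[].
rewrite big_ord_recl -(IH (A \o lift ord0))//=.
rewrite /product_cons /pushforward -product_measure1E//; last first.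
  rewrite (_ : [set t | _] =
      \bigcap_i [set t : k.-tuple T | A (lift ord0 i) (tnth t i)]); last first.
    by apply/seteqP; split => t /= At i => [_|]; exact: At.
  apply: fin_bigcap_measurable => [|i _]; first exact: finite_finset.
  by rewrite -[X in measurable X]setTI; exact: measurable_tnth.
congr ((m \x _) _); apply/seteqP; split=> -[x t] /= => [At|[Ax At] i].
  split=> [|i]; first by have := At ord0.
  by have := At (lift ord0 i); rewrite tnthS.
have [->//|[j ->]] : i = ord0 \/ exists j, i = lift ord0 j.
  by case: (unliftP ord0 i) => [j ->|->]; [right; exists j|left].
by rewrite tnthS; exact: At.
Qed.

End ProductPower.

(* Lebesgue measure on R^k, on the product sigma-algebra of k-tuples *)
Definition lebesgue_tuple (R : realType) (k : nat) :
    {sigma_finite_measure set (k.-tuple (measurableTypeR R)) -> \bar R} :=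
  product_power (@lebesgue_measure R) k.

(* The identification of R^(2n^2) with C^(n x n): real parts come first. *)
Definition complex_matrix (R : realType) (n : nat)
    (t : (n * n + n * n).-tuple R) : 'M[Cfield R]_n :=
  \matrix_(i, j) (tnth t (lshift _ (mxvec_index i j))
                  +i* tnth t (rshift _ (mxvec_index i j)))%C.

Lemma complex_matrix_bij (R : realType) (n : nat) :
  bijective (@complex_matrix R n).
Proof.
pose g (X : 'M[Cfield R]_n) : (n * n + n * n).-tuple R :=
  [tuple match fintype.split k with
         | inl l => complex.Re (mxvec X 0 l)
         | inr l => complex.Im (mxvec X 0 l)
         end | k < n * n + n * n].
exists g => [t|X].
  apply: eq_from_tnth => k; rewrite tnth_mktuple.
  case: splitP => l kl; case/mxvec_indexP: l kl => i j kl;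
    rewrite mxvecE mxE /=; congr tnth; exact/val_inj.
apply/matrixP => i j; rewrite mxE !tnth_mktuple.
rewrite (unsplitK (inl _)) (unsplitK (inr _)) mxvecE.
by case: (X i j).
Qed.

Definition almost_every_matrix (R : realType) (n : nat)
    (P : 'M[Cfield R]_n -> Prop) : Prop :=
  {ae lebesgue_tuple R (n * n + n * n), forall t, P (complex_matrix t)}.

(* Main.v *)
Require Import Defs.
From mathcomp Require Import all_boot all_order all_algebra all_fingroup.
From mathcomp Require Import all_classical all_reals all_analysis finmap.
From mathcomp Require Import measurable_realfun complex ordered_qelim qe_rcf ring lra.

(** A local minimizer is a nearest point to [A] among the normal matrices of
    some open box, and this box may be taken with rational centre and radius, so
    only countably many boxes matter. For a fixed box, consider the matrices [A]
    that have two nearest points in it, or a nearest point with a repeated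
    eigenvalue. These exceptional sets are definable in the language of ordered
    rings, hence, by quantifier elimination, described by the signs of finitely
    many polynomials. A definable set without interior points lies in the zero
    sets of finitely many nonzero polynomials, so it is null
    ([definable_negligible]). It remains to see that the exceptional sets contain
    no ball.

    If [N] is a nearest point to [A], then [N] is the only nearest point to each
    matrix of the open segment from [A] to [N], and the squared distance even
    grows quadratically away from [N] ([box_minimizer_growth]). This excludes a
    ball of matrices with two nearest points. It also makes the nearest points
    of matrices close to the segment depend on them in a Lipschitz way. Suppose
    now that all matrices of a ball had nearest points with a repeated
    eigenvalue, and choose one with as many distinct eigenvalues as possible. A
    small Hermitian perturbation [H] of [A] that separates two equal eigenvalues
    of [N] has to displace [N] by an amount comparable with [H] in the direction
    of [H], because [N + H] is normal; but no eigenvalue cluster of [N] can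
    split, and then the displacement in the direction of [H] is of second order
    ([inner_spread_le]). This contradiction is [no_open_repeated].

    For [A] outside all these null sets, each rational box has at most one
    nearest point, so there are countably many local minimizers. The values taken
    by one real coordinate on the local minimizers form a definable subset of the
    line, and a countable definable subset of the line is finite
    ([definable_countable_finite]); so the local minimizers are finitely many.

    Finally let [N0] be a local minimizer with distinct eigenvalues. The value of
    [f_flag A] at a class is the squared distance from [A] to its image under
    [N_flag A], which is normal and depends continuously on the class. Hence all
    the classes with image [N0] are local minimizers of [f_flag A]. They are the
    classes of the eigenbases of [N0], because the minimality of [N0] among the
    matrices with the same eigenvectors identifies its eigenvalues with the
    diagonal entries of [A] in such a basis ([minimizer_diag]); and an eigenbasis
    is determined, up to phases, by an ordering of the [n] eigenvalues
    ([card_flag_fiber]). *)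

Set Implicit Arguments.
Unset Strict Implicit.
Unset Printing Implicit Defensive.

Import Order.TTheory GRing.Theory Num.Theory.
Import numFieldNormedType.Exports.
Import ComplexField Normc.

Local Open Scope classical_set_scope.
Local Open Scope card_scope.
Local Open Scope ring_scope.
Local Open Scope sesquilinear_scope.
Local Open Scope quotient_scope.

(** * Definable predicates on finite lists of reals *)

Section Definable.
Variable R : realType.
Implicit Types (e : seq R) (t : GRing.term R) (f : ord.formula R).

(** As [GRing.rterm] excludes inverses, these are the polynomial functions. *)
Definition termfun (g : seq R -> R) :=
  exists2 t, GRing.rterm t & forall e, g e = GRing.eval e t.

(** Definability is meant with parameters, the constants of the formula. *)
Definition definable (P : seq R -> Prop) :=
  exists2 f, ord.rformula f & forall e, P e <-> ord.holds e f.

Lemma termfun_var i : termfun (fun e => e`_i).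
Proof. by exists (GRing.Var R i). Qed.

Lemma termfun_cst c : termfun (fun=> c).
Proof. by exists (GRing.Const c). Qed.

Lemma termfunD g h : termfun g -> termfun h -> termfun (fun e => g e + h e).
Proof.
move=> [t rt gt] [u ru hu]; exists (GRing.Add t u); first by rewrite /= rt.
by move=> e; rewrite /= gt hu.
Qed.

Lemma termfunN g : termfun g -> termfun (fun e => - g e).
Proof.
move=> [t rt gt]; exists (GRing.Opp t) => // e; by rewrite /= gt.
Qed.

Lemma termfunM g h : termfun g -> termfun h -> termfun (fun e => g e * h e).
Proof.
move=> [t rt gt] [u ru hu]; exists (GRing.Mul t u); first by rewrite /= rt.
by move=> e; rewrite /= gt hu.
Qed.

Lemma termfunB g h : termfun g -> termfun h -> termfun (fun e => g e - h e).
Proof. by move=> tg th; apply: termfunD => //; exact: termfunN. Qed.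

Lemma termfun_sum (I : Type) (r : seq I) (g : I -> seq R -> R) :
  (forall i, termfun (g i)) -> termfun (fun e => \sum_(i <- r) g i e).
Proof.
move=> tg; elim: r => [|i r IH].
  by under eq_fun do rewrite big_nil; exact: termfun_cst.
by under eq_fun do rewrite big_cons; exact: termfunD.
Qed.

Lemma definable_eq g h : termfun g -> termfun h ->
  definable (fun e => g e = h e).
Proof.
move=> [t rt gt] [u ru hu]; exists (ord.Equal t u); first by rewrite /= rt.
by move=> e; rewrite /= gt hu.
Qed.

Lemma definable_lt g h : termfun g -> termfun h ->
  definable (fun e => g e < h e).
Proof.
move=> [t rt gt] [u ru hu]; exists (ord.Lt t u); first by rewrite /= rt.
by move=> e; rewrite /= gt hu.
Qed.

Lemma definable_le g h : termfun g -> termfun h ->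
  definable (fun e => g e <= h e).
Proof.
move=> [t rt gt] [u ru hu]; exists (ord.Le t u); first by rewrite /= rt.
by move=> e; rewrite /= gt hu.
Qed.

Lemma definable_not P : definable P -> definable (fun e => ~ P e).
Proof.
by move=> [f rf Pf]; exists (ord.Not f) => //= e; rewrite Pf.
Qed.

Lemma definable_and P Q : definable P -> definable Q ->
  definable (fun e => P e /\ Q e).
Proof.
move=> [f rf Pf] [g rg Qg]; exists (ord.And f g); first by rewrite /= rf.
by move=> e /=; rewrite Pf Qg.
Qed.

Lemma definable_imp P Q : definable P -> definable Q ->
  definable (fun e => P e -> Q e).
Proof.
move=> [f rf Pf] [g rg Qg]; exists (ord.Implies f g); first by rewrite /= rf.
by move=> e /=; rewrite Pf Qg.
Qed.

Lemma definable_norm_lt g r : termfun g -> termfun r ->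
  definable (fun e => `|g e| < r e).
Proof.
move=> tg tr; rewrite (_ : (fun _ => _) = (fun e => - r e < g e /\ g e < r e)).
  by apply: definable_and; apply: definable_lt => //; exact: termfunN.
by apply/funext => e; rewrite ltr_norml propeqE; split=> /andP.
Qed.

Lemma definable_forall_fin (I : finType) (P : I -> seq R -> Prop) :
  (forall i, definable (P i)) -> definable (fun e => forall i, P i e).
Proof.
move=> dP.
have [f rf fP] : definable (fun e => forall i, i \in enum I -> P i e).
  elim: (enum I) => [|i s [f rf IH]]; first by exists (ord.Bool true).
  have [g rg Pg] := dP i; exists (ord.And g f); first by rewrite /= rg.
  move=> e; split=> [h|[/Pg Pi /IH h] j].
    split; first by apply/Pg/h/mem_head.
    by apply/IH => j js; apply: h; rewrite in_cons js orbT.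
  by rewrite inE => /predU1P[->|/h].
exists f => // e; rewrite -fP; split=> [h i _|h i]; first exact: h.
exact/h/mem_enum.
Qed.

(** Quantification over a block of variables at once: the witness is an
    environment that may differ from the current one only on that block. *)
Lemma definable_exists_vars (s : seq nat) P : definable P ->
  definable (fun e => exists2 e', {in [predC s], forall i, e'`_i = e`_i}
                                & P e').
Proof.
move=> [f rf Pf]; exists (foldr (@ord.Exists R) f s).
  by elim: s => //= i s ->.
elim: s => [|i s IH] e /=.
  split=> [[e' ee' /Pf Pe']|/Pf Pe]; last by exists e.
  by apply: ord.eq_holds Pe' => i; rewrite ee'.
split=> [[e' ee' Pe']|[x /IH[e' ee' Pe']]].
  exists e'`_i; apply/IH; exists e' => // j js.
  rewrite nth_set_nth /=; case: eqVneq => [->//|ji].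
  by apply: ee'; rewrite !inE negb_or ji.
exists e' => // j; rewrite !inE negb_or => /andP[ji js].
by rewrite ee'// nth_set_nth /= (negbTE ji).
Qed.

Definition same_signs (s : seq (GRing.term R)) e e' :=
  all (fun t => Num.sg (GRing.eval e t) == Num.sg (GRing.eval e' t)) s.

Definition sign_determined (q : seq R -> bool) :=
  exists2 s, all (@GRing.rterm R) s &
    forall e e', same_signs s e e' -> q e = q e'.

Lemma sign_determined_atom (op : rel R) (op0 : pred R) t u :
  GRing.rterm t && GRing.rterm u ->
  (forall x y, op x y = op0 (Num.sg (x - y))) ->
  sign_determined (fun e => op (GRing.eval e t) (GRing.eval e u)).
Proof.
move=> rtu opE; exists [:: GRing.Add t (GRing.Opp u)]; first by rewrite /= andbT.
by move=> e e' /=; rewrite /same_signs /= andbT !opE => /eqP ->.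
Qed.

Lemma sign_determined_pair (op : bool -> bool -> bool) p q :
  sign_determined p -> sign_determined q ->
  sign_determined (fun e => op (p e) (q e)).
Proof.
move=> [s rs hs] [s' rs' hs']; exists (s ++ s'); first by rewrite all_cat rs.
by move=> e e'; rewrite /same_signs all_cat => /andP[/hs -> /hs' ->].
Qed.

(** The content of quantifier elimination: the truth of a definable predicate
    depends only on the signs of finitely many polynomials. *)
Lemma definable_signs P : definable P -> exists2 s : seq (GRing.term R),
  all (@GRing.rterm R) s & forall e e', same_signs s e e' -> P e -> P e'.
Proof.
move=> [f rf Pf]; pose g := ord.quantifier_elim (@wproj R) f.
have /andP[qg rg] : ord.qf_form g && ord.rformula g.
  by apply: ord.quantifier_elim_wf rf; exact: wf_QE_wproj.
have Pg e : reflect (P e) (ord.qf_eval e g).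
  apply: (iffP (ord.quantifier_elim_rformP _ _ e rf)).
  - exact: wf_QE_wproj.
  - exact: valid_QE_wproj.
  - by move/Pf.
  - by move/Pf.
suff [s rs gs] : sign_determined (fun e => ord.qf_eval e g).
  by exists s => // e e' /gs ee' /Pg; rewrite ee' => /Pg.
elim: g qg rg {Pg} => //=.
- by move=> b _ _; exists [::].
- move=> t u _ rtu; apply: (@sign_determined_atom eq_op (fun x => x == 0)) => //.
  by move=> x y; rewrite sgr_eq0 subr_eq0.
- move=> t u _ rtu; apply: (@sign_determined_atom <%R (fun x => x < 0)) => //.
  by move=> x y; rewrite sgr_lt0 subr_lt0.
- move=> t u _ rtu; apply: (@sign_determined_atom <=%R (fun x => x <= 0)) => //.
  by move=> x y; rewrite sgr_le0 subr_le0.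
- move=> f1 IH1 f2 IH2 /andP[q1 q2] /andP[r1 r2].
  by apply: (sign_determined_pair andb); [exact: IH1|exact: IH2].
- move=> f1 IH1 f2 IH2 /andP[q1 q2] /andP[r1 r2].
  by apply: (sign_determined_pair orb); [exact: IH1|exact: IH2].
- move=> f1 IH1 f2 IH2 /andP[q1 q2] /andP[r1 r2].
  by apply: (sign_determined_pair implb); [exact: IH1|exact: IH2].
- move=> f1 IH1 q1 r1; have d1 := IH1 q1 r1.
  exact: (sign_determined_pair (fun b _ => ~~ b) d1 d1).
Qed.

Lemma eval_poly1 t e i : GRing.rterm t ->
  exists p : {poly R}, forall x, GRing.eval (set_nth 0 e i x) t = p.[x].
Proof.
elim: t => //=.
- move=> j _; have [->|ji] := eqVneq j i.
    by exists 'X => x; rewrite nth_set_nth /= eqxx hornerX.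
  by exists (e`_j)%:P => x; rewrite nth_set_nth /= (negbTE ji) hornerC.
- by move=> c _; exists c%:P => x; rewrite hornerC.
- by move=> m _; exists (m%:R)%:P => x; rewrite hornerC.
- move=> t IHt u IHu /andP[/IHt[p tp] /IHu[q uq]].
  by exists (p + q) => x; rewrite hornerD tp uq.
- by move=> t IHt /IHt[p tp]; exists (- p) => x; rewrite hornerN tp.
- by move=> t IHt m /IHt[p tp]; exists (p *+ m) => x; rewrite hornerMn tp.
- move=> t IHt u IHu /andP[/IHt[p tp] /IHu[q uq]].
  by exists (p * q) => x; rewrite hornerM tp uq.
- by move=> t IHt m /IHt[p tp]; exists (p ^+ m) => x; rewrite horner_exp tp.
Qed.

(** Environments are lists of unbounded length, read as finitely supported
    sequences; this is the filter of uniform neighbourhoods of such a sequence,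
    which lets the limit laws of the base field apply to polynomials in
    arbitrarily many variables. *)
Definition env_nbhs e : set_system (seq R) :=
  [set S | exists2 d : R, 0 < d &
     forall e', (forall i, `|e'`_i - e`_i| < d) -> S e'].

#[global] Instance env_nbhs_filter e : Filter (env_nbhs e).
Proof.
split; first by exists 1.
- move=> A B [d d0 Ad] [d' d'0 Bd']; exists (Num.min d d').
    by rewrite lt_min d0.
  move=> e' ee'; split; [apply: Ad|apply: Bd'] => i;
  by have := ee' i; rewrite lt_min => /andP[].
- by move=> A B AB [d d0 Ad]; exists d => // e' /Ad /AB.
Qed.

Lemma eval_cvg t e : GRing.rterm t ->
  (fun e' => GRing.eval e' t) @ env_nbhs e --> GRing.eval e t.
Proof.
elim: t => //=.
- move=> j _; apply/cvgrPdist_lt => eps eps0; exists eps => // e' ee'.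
  by rewrite distrC.
- by move=> c _; exact: cvg_cst.
- by move=> m _; exact: cvg_cst.
- by move=> t IHt u IHu /andP[/IHt tp /IHu uq]; exact: cvgD.
- by move=> t IHt /IHt; exact: cvgN.
- move=> t IHt m /IHt tp; elim: m => [|m IHm]; first exact: cvg_cst.
  by under eq_fun do rewrite mulrS; rewrite mulrS; exact: cvgD.
- by move=> t IHt u IHu /andP[/IHt tp /IHu uq]; exact: cvgM.
- move=> t IHt m /IHt tp; elim: m => [|m IHm]; first exact: cvg_cst.
  by under eq_fun do rewrite exprS; rewrite exprS; exact: cvgM.
Qed.

Lemma near_eval_sg t e : GRing.rterm t -> GRing.eval e t != 0 ->
  \forall e' \near env_nbhs e, Num.sg (GRing.eval e t) = Num.sg (GRing.eval e' t).
Proof.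
move=> rt t0; have /cvgrPdist_lt/(_ `|GRing.eval e t|) := eval_cvg (e:=e) rt.
rewrite normr_gt0 => /(_ t0); apply: filterS => e' /=.
set x := GRing.eval e t; set y := GRing.eval e' t.
case: (ltrgt0P x) => [x0|x0|x0].
- move=> h; suff y0 : 0 < y by rewrite !gtr0_sg.
  by have := ler_norm (x - y); lra.
- move=> h; suff y0 : y < 0 by rewrite !ltr0_sg.
  by have := ler_norm (y - x); rewrite distrC; lra.
- by move/eqP: t0.
Qed.

End Definable.

(** * Definable sets without interior are null *)

Section Null.
Variable R : realType.
Implicit Types (e : seq R) (t : GRing.term R).

Lemma finite_roots (p : {poly R}) : p != 0 -> finite_set [set x | root p x].
Proof.
move=> p0; apply: contrapT => /(@infinite_set_fset _ _ (size p))[B Bp sB].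
have /(max_poly_roots p0)/(_ (finmap.fset_uniq B)) : all (root p) (finmap.enum_fset B).
  by apply/allP => x xB; exact: Bp.
by rewrite ltnNge sB.
Qed.

(** Fubini along the first coordinate: off the finitely many roots in the first
    variable, the slice is again the zero set of a nonzero polynomial. Asking
    for a polynomial in each variable separately makes the hypothesis pass to
    slices. *)
Lemma polynomial_zeros_null (k : nat) (G : seq R -> R) :
  (forall j, measurable_fun setT (fun u : j.-tuple (measurableTypeR R) =>
     G u : measurableTypeR R)) ->
  (forall e i, exists p : {poly R}, forall x, G (set_nth 0 e i x) = p.[x]) ->
  (exists u : k.-tuple R, G u != 0) ->
  lebesgue_tuple R k [set u : k.-tuple R | G u = 0] = 0%E.
Proof.
elim: k G => [|k IH] G mG pG [u Gu].
  rewrite (_ : [set _ | _] = set0) ?measure0// -subset0 => v /=.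
  by rewrite (tuple0 v) -(tuple0 u) => /eqP; rewrite (negbTE Gu).
have mG0 j : measurable [set u : j.-tuple (measurableTypeR R) | G u = 0].
  have := mG j measurableT [set 0] (measurable_set1 _).
  by rewrite setTI.
have [x0 [v uE]] : exists x0, exists v : k.-tuple R, u = x0 :: v :> seq R.
  by case/tupleP: u Gu => x0 v _; exists x0, v.
have [p pE] := pG (0 :: v) 0%N.
have p0 : p != 0.
  apply: contraNneq Gu => p0.
  by rewrite uE; have := pE x0; rewrite p0 horner0 /= => ->.
have rc := finite_set_countable (finite_roots p0).
rewrite /lebesgue_tuple /= /product_cons /pushforward /product_measure1.
rewrite (ae_eq_integral (cst 0%E)) ?integral0//.
- apply: measurable_fun_xsection.
  rewrite -[X in measurable X]setTI; apply: measurable_cons_pair => //.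
  exact: mG0.
- exists [set x | root p x]; split.
  + by apply: countable_measurable => [x|//]; exact: measurable_set1.
  + exact: countable_lebesgue_measure0.
  move=> x /= ; apply: contra_notP => /negP px _ /=.
  rewrite (_ : xsection _ _ = [set w : k.-tuple R | G (x :: w) = 0]); last first.
    by apply/seteqP; split => w; rewrite /xsection /= in_setE.
  apply: (IH (fun w => G (x :: w))).
  + move=> j; apply: (measurableT_comp (mG j.+1)).
    by apply: measurable_cons => //; exact: measurable_cst.
  + by move=> e i; have [q qE] := pG (x :: e) i.+1; exists q.
  + by exists v; have := pE x; rewrite /= => ->.
Qed.

Lemma measurable_eval t k : GRing.rterm t ->
  measurable_fun setT (fun u : k.-tuple (measurableTypeR R) =>
     GRing.eval (u : seq R) t : measurableTypeR R).
Proof.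
elim: t => //=.
- move=> j _; have [jk|jk] := ltnP j k.
    rewrite (_ : (fun _ => _) = (@tnth _ _ ^~ (Ordinal jk))).
      exact: measurable_tnth.
    by apply/funext => u; rewrite (tnth_nth 0).
  rewrite (_ : (fun _ => _) = cst 0); first exact: measurable_cst.
  by apply/funext => u; rewrite nth_default// size_tuple.
- by move=> t IHt u IHu /andP[/IHt tp /IHu uq]; exact: measurable_funD.
- by move=> t IHt /IHt ?; exact: measurable_funN.
- move=> t IHt m /IHt tp; elim: m => [|m IHm]; first exact: measurable_cst.
  by under eq_fun do rewrite mulrS; exact: measurable_funD.
- by move=> t IHt u IHu /andP[/IHt tp /IHu uq]; exact: measurable_funM.
- move=> t IHt m /IHt tp; exact: measurable_funX.
Qed.

(** Off the zeros of its nonzero defining polynomials, a definable set is open;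
    so one without interior points lies in a null set. *)
Lemma definable_negligible (P : seq R -> Prop) (k : nat) : definable P ->
  (forall (u : k.-tuple R) (d : R), 0 < d -> P u ->
     exists2 v : k.-tuple R, forall i, `|tnth v i - tnth u i| < d & ~ P v) ->
  (lebesgue_tuple R k).-negligible [set u : k.-tuple R | P u].
Proof.
move=> /definable_signs[s rs sP] noint.
pose Z t := if asbool (exists u : k.-tuple R, GRing.eval u t != 0)
            then [set u : k.-tuple R | GRing.eval u t = 0] else set0.
have Z0 : (lebesgue_tuple R k).-negligible
    (\bigcup_j Z (nth (GRing.Const (0 : R)) s j)).
  apply: negligible_bigcup => j; set t := nth _ _ _.
  have rt : GRing.rterm t.
    have [js|js] := ltnP j (size s); first exact: (all_nthP _ rs).
    by rewrite /t nth_default.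
  rewrite /Z; case: asboolP => [ex|_]; last exact: negligible_set0.
  apply/negligibleP.
    have := @measurable_eval t k rt measurableT _ (measurable_set1 (0 : R)).
    by rewrite setTI.
  apply: (polynomial_zeros_null (G := fun e => GRing.eval e t)) => //.
    by move=> j'; exact: measurable_eval.
  by move=> e i; exact: eval_poly1.
apply: negligibleS Z0 => u /= Pu.
apply: contrapT => nZ.
have sg_near : \forall e' \near env_nbhs u,
    forall v : k.-tuple R, e' = v :> seq R -> same_signs s u v.
  have {nZ} : forall j, ~ Z (nth (GRing.Const (0 : R)) s j) u.
    by move=> j Zj; apply: nZ; exists j.
  elim: s rs {sP} => [|t s IH] /=; first by move=> _ _; by apply: nearW.
  move=> /andP[rt rs] nZ.
  have {}IH := IH rs (fun j => nZ j.+1).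
  have [tu|tu] := eqVneq (GRing.eval u t) 0.
    apply: filterS IH => e' IH v e'v; apply/andP; split; last exact: IH.
    have := nZ 0%N; rewrite /= /Z; case: asboolP => // nex _.
    suff -> : GRing.eval v t = 0 by rewrite tu.
    by apply: contrapT => /eqP tv; apply: nex; exists v.
  have := near_eval_sg rt tu; apply: filterS2 IH => e' IH tu' v e'v.
  by apply/andP; split; [rewrite tu' e'v|exact: IH].
have [d d0 sgd] := sg_near.
have [v uv nPv] := noint u d d0 Pu.
apply: nPv; apply: sP Pu; apply: (sgd v) => // i.
have [ik|ik] := ltnP i k; last by rewrite !nth_default ?size_tuple// subrr normr0.
by have := uv (Ordinal ik); rewrite !(tnth_nth 0).
Qed.

Lemma set_nth_dist e i (x y : R) d : 0 < d -> `|y - x| < d ->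
  forall j, `|(set_nth 0 e i y)`_j - (set_nth 0 e i x)`_j| < d.
Proof.
move=> d0 xyd j; rewrite !nth_set_nth /=; case: eqP => // _.
by rewrite subrr normr0.
Qed.

(** One-dimensional tameness: a definable subset of the line is open off
    finitely many points, whereas a countable one contains no interval. *)
Lemma definable_countable_finite (P : seq R -> Prop) e i : definable P ->
  countable [set x | P (set_nth 0 e i x)] ->
  finite_set [set x | P (set_nth 0 e i x)].
Proof.
move=> /definable_signs[s rs sP] cP.
pose t0 := GRing.Const (0 : R).
have /choice[p pE] : forall j, exists p : {poly R},
    forall x, GRing.eval (set_nth 0 e i x) (nth t0 s j) = p.[x].
  move=> j; apply: eval_poly1.
  have [js|js] := ltnP j (size s); first exact: (all_nthP _ rs).
  by rewrite nth_default.
pose Z := \bigcup_(j in `I_(size s)) [set x | p j != 0 /\ root (p j) x].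
apply: (@sub_finite_set _ _ Z).
  move=> x /= Px; apply: contrapT => nZ.
  have sgn : \forall e' \near env_nbhs (set_nth 0 e i x),
      forall y, e' = set_nth 0 e i y -> same_signs s (set_nth 0 e i x) e'.
    have {nZ} nZ j : (j < size s)%N -> ~ (p j != 0 /\ root (p j) x).
      by move=> js pj; apply: nZ; exists j.
    clear cP sP Z Px; elim: s p rs pE nZ => [|t s IH] p /=.
      by move=> _ _ _; by apply: nearW.
    move=> /andP[rt rs] pE nZ.
    have {}IH := IH (p \o S) rs (fun j => pE j.+1) (fun j => nZ j.+1).
    have [tx|tx] := eqVneq (GRing.eval (set_nth 0 e i x) t) 0.
      have p0 : p 0%N = 0.
        apply/eqP; apply: contrapT => /negP p0; apply: (nZ 0%N) => //; split=> //.
        by rewrite /root -(pE 0%N x) /= tx.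
      apply: filterS IH => e' IH y e'y; apply/andP; split; last exact: (IH y).
      by rewrite e'y !(pE 0%N) p0 !horner0.
    have := near_eval_sg rt tx; apply: filterS2 IH => e' IH tx' y e'y.
    by apply/andP; split; [rewrite tx'|exact: (IH y)].
  have [d d0 sgd] := sgn.
  have : countable `]x - d, x + d[.
    apply: sub_countable cP; apply: subset_card_le => y /=.
    rewrite in_itv /= => /andP[xy yx]; apply: sP Px; apply: (sgd _ _ y) => //.
    by apply: set_nth_dist => //; rewrite ltr_norml; lra.
  move=> /countable_lebesgue_measure0.
  rewrite lebesgue_measure_itv /= lte_fin ifT; last lra.
  by rewrite -EFinB => -[]; lra.
apply: bigcup_finite => // j _.
have [->|pj] := eqVneq (p j) 0; first by apply: (sub_finite_set _ (finite_set0 _)) => x /= [] /eqP.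
by apply: sub_finite_set (finite_roots pj) => x [].
Qed.

End Null.

(** * Definability of predicates on complex matrices *)

Section MatrixDefinable.
Variables (R : realType) (n : nat).
Local Notation C := (Cfield R).
Local Notation M := 'M[C]_n.
Local Notation dim := (n * n + n * n)%N.

Lemma ReCM (x y : C) : complex.Re (x * y) =
  complex.Re x * complex.Re y - complex.Im x * complex.Im y.
Proof. by case: x y => a b [c d]. Qed.
Lemma ImCM (x y : C) : complex.Im (x * y) =
  complex.Re x * complex.Im y + complex.Im x * complex.Re y.
Proof. by case: x y => a b [c d]. Qed.
Lemma ReCD (x y : C) : complex.Re (x + y) = complex.Re x + complex.Re y.
Proof. by case: x y => a b [c d]. Qed.
Lemma ImCD (x y : C) : complex.Im (x + y) = complex.Im x + complex.Im y.
Proof. by case: x y => a b [c d]. Qed.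
Lemma ReCN (x : C) : complex.Re (- x) = - complex.Re x.
Proof. by case: x. Qed.
Lemma ImCN (x : C) : complex.Im (- x) = - complex.Im x.
Proof. by case: x. Qed.
Lemma ReC_conj (x : C) : complex.Re (x^*) = complex.Re x.
Proof. by case: x. Qed.
Lemma ImC_conj (x : C) : complex.Im (x^*) = - complex.Im x.
Proof. by case: x. Qed.
Lemma ReC_sum (I : Type) (r : seq I) (F : I -> C) :
  complex.Re (\sum_(i <- r) F i) = \sum_(i <- r) complex.Re (F i).
Proof. exact: (big_morph _ ReCD). Qed.
Lemma ImC_sum (I : Type) (r : seq I) (F : I -> C) :
  complex.Im (\sum_(i <- r) F i) = \sum_(i <- r) complex.Im (F i).
Proof. exact: (big_morph _ ImCD). Qed.
Lemma complex_eqE (x y : C) :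
  (x = y) = (complex.Re x = complex.Re y /\ complex.Im x = complex.Im y).
Proof.
by rewrite propeqE; split=> [->//|]; case: x y => a b [c d] /= [-> ->].
Qed.

(** An environment lists the real coordinates of infinitely many matrix
    variables one after the other. *)
Definition block (e : seq R) (b : nat) : M :=
  complex_matrix [tuple e`_(b * dim + k) | k < dim].

Definition real_poly (g : (nat -> M) -> R) := termfun (fun e => g (block e)).
Definition complex_poly (g : (nat -> M) -> C) :=
  real_poly (fun B => complex.Re (g B)) /\ real_poly (fun B => complex.Im (g B)).
Definition matrix_poly (G : (nat -> M) -> M) :=
  forall i j, complex_poly (fun B => G B i j).
Definition matrix_definable (P : (nat -> M) -> Prop) :=
  definable (fun e => P (block e)).

Lemma complex_polyD g h : complex_poly g -> complex_poly h ->
  complex_poly (fun B => g B + h B).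
Proof.
move=> [g1 g2] [h1 h2]; split; rewrite /real_poly.
  by under eq_fun do rewrite ReCD; exact: termfunD.
by under eq_fun do rewrite ImCD; exact: termfunD.
Qed.

Lemma complex_polyN g : complex_poly g -> complex_poly (fun B => - g B).
Proof.
move=> [g1 g2]; split; rewrite /real_poly.
  by under eq_fun do rewrite ReCN; exact: termfunN.
by under eq_fun do rewrite ImCN; exact: termfunN.
Qed.

Lemma complex_polyM g h : complex_poly g -> complex_poly h ->
  complex_poly (fun B => g B * h B).
Proof.
move=> [g1 g2] [h1 h2]; split; rewrite /real_poly.
  by under eq_fun do rewrite ReCM; apply: termfunB; exact: termfunM.
by under eq_fun do rewrite ImCM; apply: termfunD; exact: termfunM.
Qed.

Lemma complex_poly_conj g : complex_poly g -> complex_poly (fun B => (g B)^*).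
Proof.
move=> [g1 g2]; split; rewrite /real_poly.
  by under eq_fun do rewrite ReC_conj.
by under eq_fun do rewrite ImC_conj; exact: termfunN.
Qed.

Lemma complex_poly_sum (I : Type) (r : seq I) (g : I -> (nat -> M) -> C) :
  (forall i, complex_poly (g i)) -> complex_poly (fun B => \sum_(i <- r) g i B).
Proof.
move=> cg; split; rewrite /real_poly.
  by under eq_fun do rewrite ReC_sum; apply: termfun_sum => i; have [] := cg i.
by under eq_fun do rewrite ImC_sum; apply: termfun_sum => i; have [] := cg i.
Qed.

Lemma matrix_poly_var b : matrix_poly (fun B => B b).
Proof.
move=> i j; split; rewrite /real_poly /=.
  under eq_fun do rewrite mxE /= tnth_mktuple; exact: termfun_var.
under eq_fun do rewrite mxE /= tnth_mktuple; exact: termfun_var.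
Qed.

Lemma matrix_poly_cst A : matrix_poly (fun=> A).
Proof. by move=> i j; split; exact: termfun_cst. Qed.

Lemma matrix_polyB G H : matrix_poly G -> matrix_poly H ->
  matrix_poly (fun B => G B - H B).
Proof.
move=> mG mH i j; rewrite (_ : (fun _ => _) = (fun B => G B i j + - H B i j)).
  by apply: complex_polyD; [exact: mG|exact/complex_polyN/mH].
by apply/funext => B; rewrite !mxE.
Qed.

Lemma matrix_polyM G H : matrix_poly G -> matrix_poly H ->
  matrix_poly (fun B => G B *m H B).
Proof.
move=> mG mH i j.
rewrite (_ : (fun _ => _) = (fun B => \sum_k G B i k * H B k j)).
  apply: complex_poly_sum => k; apply: complex_polyM; [exact: mG|exact: mH].
by apply/funext => B; rewrite !mxE.
Qed.

Lemma matrix_poly_adj G : matrix_poly G -> matrix_poly (fun B => (G B)^t*).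
Proof.
move=> mG i j; rewrite (_ : (fun _ => _) = (fun B => (G B j i)^*)).
  exact/complex_poly_conj/mG.
by apply/funext => B; rewrite !mxE.
Qed.

Lemma real_poly_frobenius2 G : matrix_poly G ->
  real_poly (fun B => frobenius2 (G B)).
Proof.
move=> mG; rewrite /real_poly /frobenius2.
have [] : complex_poly (fun B => \tr ((G B)^t* *m G B)) => //.
apply: (@complex_poly_sum _ _ (fun i B => ((G B)^t* *m G B) i i)) => i.
exact: (matrix_polyM (matrix_poly_adj mG) mG).
Qed.

Lemma matrix_definable_eqc g h : complex_poly g -> complex_poly h ->
  matrix_definable (fun B => g B = h B).
Proof.
move=> [g1 g2] [h1 h2]; rewrite /matrix_definable.
by under eq_fun do rewrite complex_eqE; apply: definable_and; exact: definable_eq.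
Qed.

Lemma matrix_definable_eq G H : matrix_poly G -> matrix_poly H ->
  matrix_definable (fun B => G B = H B).
Proof.
move=> mG mH; rewrite /matrix_definable.
rewrite (_ : (fun _ => _) = (fun e => forall i, forall j,
    G (block e) i j = H (block e) i j)).
  apply: (definable_forall_fin (P := fun i e => forall j,
    G (block e) i j = H (block e) i j)) => i.
  apply: (definable_forall_fin (P := fun j e =>
    G (block e) i j = H (block e) i j)) => j.
  exact: (matrix_definable_eqc (mG i j) (mH i j)).
by apply/funext => e; rewrite propeqE; split=> [->//|h]; apply/matrixP.
Qed.

Definition update (B : nat -> M) b X b' := if b' == b then X else B b'.

Lemma block_disjoint b b' (k : 'I_dim) : b' != b ->
  ~~ (b * dim <= b' * dim + k < b * dim + dim)%N.
Proof.
rewrite negb_and -ltnNge -leqNgt neq_ltn => /orP[b'b|bb'].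
  rewrite (leq_trans (_ : _ < b'.+1 * dim)%N) //.
    by rewrite mulSn addnC ltn_add2r.
  by rewrite leq_mul2r b'b orbT.
apply/orP; right; rewrite addnC -mulSn.
by rewrite (leq_trans _ (leq_addr _ _))// leq_mul2r bb' orbT.
Qed.

(** The second hypothesis says that [P] has no other occurrence of the block [b],
    which can therefore serve as the bound variable. *)
Lemma matrix_definable_exists b (P : (nat -> M) -> M -> Prop) :
  matrix_definable (fun B => P B (B b)) ->
  (forall B X Y, P (update B b Y) X = P B X) ->
  matrix_definable (fun B => exists X, P B X).
Proof.
move=> /(definable_exists_vars (iota (b * dim) dim)) dP Pb.
rewrite /matrix_definable.
congr definable: dP; apply/funext => e; rewrite propeqE.
have blockP e' : (forall b', b' != b -> block e' b' = block e b') ->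
    P (block e') = P (block e).
  move=> ee'; apply/funext => X; rewrite -[LHS](Pb _ _ 0) -[RHS](Pb _ _ 0).
  by congr P; apply/funext => b'; rewrite /update; case: eqVneq => // /ee'.
split=> [[e' ee' Pe']|[X PX]].
  exists (block e' b); rewrite -(blockP e')// => b' b'b.
  rewrite /block; congr complex_matrix; apply: eq_from_tnth => k.
  by rewrite !tnth_mktuple ee'// !inE mem_iota (negbTE (block_disjoint _ _)).
have [g _ gK] := complex_matrix_bij R n.
pose e' := mkseq (fun i => if (b * dim <= i < b * dim + dim)%N
  then (g X)`_(i - b * dim) else e`_i) (maxn (size e) (b * dim + dim)).
have nth_e' i : e'`_i = if (b * dim <= i < b * dim + dim)%N
    then (g X)`_(i - b * dim) else e`_i.
  have [i_lt|i_ge] := ltnP i (maxn (size e) (b * dim + dim)).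
    by rewrite nth_mkseq.
  rewrite nth_default ?size_mkseq//.
  move: i_ge; rewrite geq_max => /andP[ei bi]; rewrite ltnNge bi andbF.
  by rewrite nth_default.
exists e'; first by move=> i; rewrite !inE mem_iota nth_e' => /negbTE ->.
have e'b : block e' b = X.
  rewrite -[RHS]gK; congr complex_matrix; apply: eq_from_tnth => k.
  rewrite tnth_mktuple nth_e' leq_addr ltn_add2l ltn_ord /= addKn.
  by rewrite (tnth_nth 0).
rewrite e'b blockP// => b' b'b.
rewrite /block; congr complex_matrix; apply: eq_from_tnth => k.
by rewrite !tnth_mktuple nth_e' (negbTE (block_disjoint _ _)).
Qed.

Lemma matrix_definable_forall b (P : (nat -> M) -> M -> Prop) :
  matrix_definable (fun B => P B (B b)) ->
  (forall B X Y, P (update B b Y) X = P B X) ->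
  matrix_definable (fun B => forall X, P B X).
Proof.
move=> dP Pb; rewrite /matrix_definable.
rewrite (_ : (fun _ => _) = (fun e => ~ (exists X, ~ P (block e) X))); last first.
  apply/funext => e; rewrite propeqE; split=> [h [X]|h X]; first exact.
  by apply: contrapT => nP; apply: h; exists X.
apply/definable_not/(@matrix_definable_exists b (fun B X => ~ P B X)).
  exact: definable_not.
by move=> B X Y; rewrite Pb.
Qed.

Definition in_box (p : M) (r : R) (X : M) := forall i j,
  `|complex.Re ((X - p) i j)| < r /\ `|complex.Im ((X - p) i j)| < r.

Definition box_minimizer p r A N := [/\ N \is normalmx, in_box p r N &
  forall X, X \is normalmx -> in_box p r X ->
    frobenius2 (A - N) <= frobenius2 (A - X)].

Lemma matrix_definable_normal G : matrix_poly G ->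
  matrix_definable (fun B => G B \is normalmx).
Proof.
move=> mG; rewrite /matrix_definable.
rewrite (_ : (fun _ => _) = (fun e => G (block e) *m (G (block e))^t* =
                                    (G (block e))^t* *m G (block e))).
  have mG' := matrix_poly_adj mG.
  exact: (matrix_definable_eq (matrix_polyM mG mG') (matrix_polyM mG' mG)).
by apply/funext => e; rewrite propeqE; split=> /normalmxP.
Qed.

Lemma matrix_definable_box Gp r G : matrix_poly Gp -> real_poly r ->
  matrix_poly G -> matrix_definable (fun B => in_box (Gp B) (r B) (G B)).
Proof.
move=> mp pr mG; rewrite /matrix_definable /in_box.
apply: (definable_forall_fin (P := fun i e => forall j,
  `|complex.Re ((G (block e) - Gp (block e)) i j)| < r (block e) /\
  `|complex.Im ((G (block e) - Gp (block e)) i j)| < r (block e))) => i.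
apply: (definable_forall_fin (P := fun j e =>
  `|complex.Re ((G (block e) - Gp (block e)) i j)| < r (block e) /\
  `|complex.Im ((G (block e) - Gp (block e)) i j)| < r (block e))) => j.
have [p1 p2] := matrix_polyB mG mp i j.
by apply: definable_and; exact: definable_norm_lt.
Qed.

(** The fresh block [b] is the variable bound in [box_minimizer]. *)
Lemma matrix_definable_minimizer b Gp r GA GN : matrix_poly Gp -> real_poly r ->
  matrix_poly GA -> matrix_poly GN ->
  (forall B Y, [/\ Gp (update B b Y) = Gp B, r (update B b Y) = r B,
     GA (update B b Y) = GA B & GN (update B b Y) = GN B]) ->
  matrix_definable (fun B => box_minimizer (Gp B) (r B) (GA B) (GN B)).
Proof.
move=> mp pr mA mN fresh; rewrite /matrix_definable.
rewrite (_ : (fun _ => _) = (fun e => GN (block e) \is normalmx /\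
  (in_box (Gp (block e)) (r (block e)) (GN (block e)) /\
   forall X, X \is normalmx -> in_box (Gp (block e)) (r (block e)) X ->
     frobenius2 (GA (block e) - GN (block e)) <= frobenius2 (GA (block e) - X)))).
  apply: definable_and; first exact: (matrix_definable_normal mN).
  apply: definable_and; first exact: (matrix_definable_box mp pr mN).
  apply: (@matrix_definable_forall b (fun B X => X \is normalmx ->
    in_box (Gp B) (r B) X ->
    frobenius2 (GA B - GN B) <= frobenius2 (GA B - X))); last first.
    by move=> B X Y; have [-> -> -> ->] := fresh B Y.
  have mb := matrix_poly_var b.
  apply: definable_imp; first exact: (matrix_definable_normal mb).
  apply: definable_imp; first exact: (matrix_definable_box mp pr mb).
  exact: (definable_le (real_poly_frobenius2 (matrix_polyB mA mN))
                       (real_poly_frobenius2 (matrix_polyB mA mb))).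
by apply/funext => e; rewrite propeqE; split=> [[]|[? []]].
Qed.

End MatrixDefinable.

(** * Inequalities between real numbers *)

Section RealInequalities.
Variable R : realFieldType.

Lemma shrink_growth (a b c e : R) : e < 1 -> a <= a - 2 * b + c ->
  (1 - e) ^+ 2 * a + e * c <= (1 - e) ^+ 2 * a - 2 * ((1 - e) * b) + c.
Proof.
move=> e1 abc; suff : 0 <= (1 - e) * (c - 2 * b) by lra.
by rewrite mulr_ge0; lra.
Qed.

Lemma small_factor (F d : R) : 0 <= F -> 0 < d ->
  exists2 e : R, 0 < e < 1 & e * F < d.
Proof.
move=> F0 d0; exists (d / (1 + F + d)).
  by rewrite divr_gt0 ?ltr_pdivrMr /=; lra.
rewrite mulrAC ltr_pdivrMr; last lra.
by rewrite ltr_pM2l//; lra.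
Qed.

Lemma weighted_le (b x y w g : R) : 0 <= b -> 0 < g -> 2 * g <= x -> y <= 2 * x ->
  b * x ^+ 2 <= w -> b * y <= 2 / g * w.
Proof.
move=> b0 g0 gx yx bw; rewrite [leRHS]mulrAC ler_pdivlMr//.
apply: (@le_trans _ _ (b * (2 * x) * g)).
  by rewrite ler_wpM2r ?(ltW g0)// ler_wpM2l.
have : b * x * g <= b * x * x.
  by rewrite ler_wpM2l//; [rewrite mulr_ge0//; lra|lra].
by rewrite expr2 in bw; lra.
Qed.

Lemma norm_sub_le (x y z u v : R) : `|x| <= z -> `|y| <= z ->
  x + u - v - (y + u - v) <= 2 * z.
Proof. by rewrite !ler_norml => /andP[? ?] /andP[? ?]; lra. Qed.

Lemma growth_combine (a b c h e w : R) :
  a + e * w <= b -> b + 2 * - c + h <= a -> h + e * w <= 2 * c.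
Proof. lra. Qed.

(** Here [h] and [w] stand for the squared sizes of a perturbation and of the
    displacement of the nearest point that it causes, and [c] for their inner
    product; the last hypothesis says that a squared norm is nonnegative. *)
Lemma displacement_bound (e g t h c w : R) : 0 < e -> 0 < g -> 0 < t ->
  h = t ^+ 2 * 2 -> t * 8 < e * g -> h + e * w <= 2 * c ->
  0 <= (e / 2) ^+ 2 * w - 2 * (e / 2 * c) + h -> w < g ^+ 2.
Proof.
move=> e0 g0 t0 -> tg hc wc.
have ew : e ^+ 2 * w <= 8 * t ^+ 2 by nra.
have : (t * 8) ^+ 2 < (e * g) ^+ 2.
  by rewrite ltr_pXn2r ?nnegrE ?mulr_ge0 ?ltW.
move=> h1; rewrite -(ltr_pM2l (exprn_gt0 2 e0)) -exprMn.
by apply: le_lt_trans ew _; apply: le_lt_trans h1; nra.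
Qed.

(** With the notations above, except that [t * c] is now the inner product: the
    displacement in the direction of the perturbation is not of second order. *)
Lemma displacement_contra (e g m t c w : R) : 0 < g -> 0 < t -> 0 <= w ->
  t * (8 * m / g) < e -> t ^+ 2 * 2 + e * w <= 2 * (t * c) ->
  4 * m / g * w < c.
Proof.
move=> g0 t0 w0 te h; rewrite -(ltr_pM2l t0) -(ltr_pM2l (ltr0n R 2)).
have t2 : 0 < t ^+ 2 * 2 by rewrite mulr_gt0 ?exprn_gt0.
apply: lt_le_trans h.
have : t * (8 * m / g) * w <= e * w by rewrite ler_wpM2r// ltW.
have -> : 2 * (t * (4 * m / g * w)) = t * (8 * m / g) * w.
  by field; rewrite gt_eqF.
lra.
Qed.

Lemma linear_beats_square (t x F : R) : 0 < t -> t * 2 < 2 * x ->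
  ~ (F <= F - 2 * (t * x) + t ^+ 2 * 2).
Proof.
move=> t0 tx; apply/negP; rewrite -ltNge; have : t * t < t * x by rewrite ltr_pM2l//; lra.
by rewrite expr2; lra.
Qed.

Lemma small_step_nonpos (t x F : R) : 0 < t -> t < 1 ->
  F <= F - 2 * (t * x) + t ^+ 2 * x -> x <= 0.
Proof.
move=> t0 t1; have : 0 < t * (2 - t) by rewrite mulr_gt0//; lra.
by move=> tt h; rewrite -(pmulr_rle0 _ tt); lra.
Qed.

End RealInequalities.

(** * The Frobenius inner product and nearest points in a box *)

Section Frobenius.
Variables (R : realType) (n : nat).
Local Notation C := (Cfield R).
Local Notation M := 'M[C]_n.
Implicit Types X Y Z : M.

Lemma sqr_normcE (z : C) :
  normc z ^+ 2 = complex.Re z ^+ 2 + complex.Im z ^+ 2.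
Proof. by case: z => a b; rewrite /normc sqr_sqrtr// addr_ge0// sqr_ge0. Qed.

Lemma normc_ge0 (z : C) : 0 <= normc z.
Proof. by case: z => a b; rewrite /normc sqrtr_ge0. Qed.

Lemma Re_le_normc (z : C) : `|complex.Re z| <= normc z.
Proof.
rewrite -(@ler_pXn2r _ 2) ?nnegrE ?normc_ge0// sqr_normcE real_normK ?num_real//.
by rewrite lerDl sqr_ge0.
Qed.

Lemma Im_le_normc (z : C) : `|complex.Im z| <= normc z.
Proof.
rewrite -(@ler_pXn2r _ 2) ?nnegrE ?normc_ge0// sqr_normcE real_normK ?num_real//.
by rewrite lerDr sqr_ge0.
Qed.

Lemma ReC_conjM (z w : C) : complex.Re (z^* * w : C) =
  complex.Re z * complex.Re w + complex.Im z * complex.Im w.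
Proof. by rewrite ReCM ReC_conj ImC_conj mulNr opprK. Qed.

(** The real inner product of which [frobenius2] is the squared norm. *)
Definition inner X Y : R := complex.Re (\tr (X^t* *m Y)).

Lemma innerE X Y : inner X Y = \sum_i \sum_j
  (complex.Re (X i j) * complex.Re (Y i j) +
   complex.Im (X i j) * complex.Im (Y i j)).
Proof.
rewrite /inner /mxtrace ReC_sum exchange_big /=; apply: eq_bigr => i _.
rewrite mxE ReC_sum; apply: eq_bigr => j _.
by rewrite !mxE ReC_conjM.
Qed.

Lemma frobenius2_inner X : frobenius2 X = inner X X. Proof. by []. Qed.

Lemma frobenius2_sum X : frobenius2 X = \sum_i \sum_j normc (X i j) ^+ 2.
Proof.
rewrite frobenius2_inner innerE; apply: eq_bigr => i _; apply: eq_bigr => j _.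
by rewrite sqr_normcE !expr2.
Qed.

Lemma frobenius2_ge0 X : 0 <= frobenius2 X.
Proof.
by rewrite frobenius2_sum; do 2!apply: sumr_ge0 => ? _; rewrite sqr_ge0.
Qed.

Lemma sqr_normc_le_frobenius2 X i j : normc (X i j) ^+ 2 <= frobenius2 X.
Proof.
rewrite frobenius2_sum (bigD1 i)//= (bigD1 j)//= -addrA lerDl addr_ge0//.
  by apply: sumr_ge0 => ? _; rewrite sqr_ge0.
by do 2!apply: sumr_ge0 => ? _; rewrite sqr_ge0.
Qed.

Lemma frobenius2_eq0 X : frobenius2 X = 0 -> X = 0.
Proof.
move=> X0; apply/matrixP => i j; rewrite mxE; apply: eq0_normc.
apply/eqP; rewrite -sqrf_eq0 eq_le sqr_ge0 andbT -X0.
exact: sqr_normc_le_frobenius2.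
Qed.

Lemma innerC X Y : inner X Y = inner Y X.
Proof.
rewrite !innerE; apply: eq_bigr => i _; apply: eq_bigr => j _.
by rewrite [X in X + _]mulrC [X in _ + X]mulrC.
Qed.

Lemma innerDr X Y Z : inner X (Y + Z) = inner X Y + inner X Z.
Proof. by rewrite /inner mulmxDr linearD ReCD. Qed.

Lemma innerNr X Y : inner X (- Y) = - inner X Y.
Proof. by rewrite /inner mulmxN linearN ReCN. Qed.

Lemma innerZr X Y (a : R) : inner X ((a%:C)%C *: Y) = a * inner X Y.
Proof. by rewrite /inner -scalemxAr linearZ /= ReCM /= mul0r subr0. Qed.

Lemma innerDl X Y Z : inner (Y + Z) X = inner Y X + inner Z X.
Proof. by rewrite !(innerC _ X) innerDr. Qed.

Lemma innerNl X Y : inner (- Y) X = - inner Y X.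
Proof. by rewrite !(innerC _ X) innerNr. Qed.

Lemma innerZl X Y (a : R) : inner ((a%:C)%C *: Y) X = a * inner Y X.
Proof. by rewrite !(innerC _ X) innerZr. Qed.

Definition inner_lin := (innerDr, innerDl, innerNr, innerNl, innerZr, innerZl).

Lemma frobenius2D X Y :
  frobenius2 (X + Y) = frobenius2 X + 2 * inner X Y + frobenius2 Y.
Proof. by rewrite !frobenius2_inner !inner_lin (innerC Y X); ring. Qed.

Lemma frobenius2N X : frobenius2 (- X) = frobenius2 X.
Proof. by rewrite !frobenius2_inner !inner_lin opprK. Qed.

Lemma frobenius2B X Y :
  frobenius2 (X - Y) = frobenius2 X - 2 * inner X Y + frobenius2 Y.
Proof. by rewrite frobenius2D frobenius2N innerNr mulrN. Qed.

Lemma frobenius2Z X (a : R) :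
  frobenius2 ((a%:C)%C *: X) = a ^+ 2 * frobenius2 X.
Proof. by rewrite !frobenius2_inner !inner_lin mulrA expr2. Qed.

Lemma frobenius2_unitaryl (Q X : M) : Q \is unitarymx ->
  frobenius2 (Q *m X) = frobenius2 X.
Proof.
move=> uQ; rewrite /frobenius2 trmx_mul map_mxM !mulmxA.
by rewrite mulmxKtV.
Qed.

Lemma frobenius2_unitaryr (Q X : M) : Q \is unitarymx ->
  frobenius2 (X *m Q) = frobenius2 X.
Proof.
move=> /unitarymxP uQ; rewrite /frobenius2 trmx_mul map_mxM mxtrace_mulC !mulmxA.
by rewrite -(mulmxA X) uQ mulmx1 mxtrace_mulC.
Qed.

End Frobenius.

Section Boxes.
Variables (R : realType) (n : nat).
Local Notation C := (Cfield R).
Local Notation M := 'M[C]_n.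
Implicit Types X Y Z : M.

Lemma in_box_open p r X : in_box p r X -> exists2 d : R, 0 < d &
  forall Y, frobenius2 (Y - X) < d -> in_box p r Y.
Proof.
move=> bX.
pose m i j := Num.min (r - `|complex.Re ((X - p) i j)|)
                      (r - `|complex.Im ((X - p) i j)|).
pose d := \big[Num.min/1]_i \big[Num.min/1]_j m i j.
have d0 : 0 < d.
  rewrite /d lt_bigmin// => i _; rewrite lt_bigmin// => j _.
  by have [? ?] := bX i j; rewrite lt_min !subr_gt0; apply/andP.
exists (d ^+ 2); first exact: exprn_gt0.
move=> Y YX i j.
have dm : d <= m i j.
  by apply: le_trans (bigmin_le _ i _) _; rewrite ?bigmin_le.
have : normc ((Y - X) i j) < d.
  rewrite -(@ltr_pXn2r _ 2) ?nnegrE ?normc_ge0 ?(ltW d0)//.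
  by apply: le_lt_trans YX; exact: sqr_normc_le_frobenius2.
have := Re_le_normc ((Y - X) i j); have := Im_le_normc ((Y - X) i j).
move: dm; rewrite /m le_min => /andP[d1 d2] l1 l2 l3.
have -> : Y - p = (Y - X) + (X - p) by rewrite addrA subrK.
rewrite mxE ReCD ImCD; split; apply: le_lt_trans (ler_normD _ _) _; lra.
Qed.

Definition segment (A N : M) (e : R) : M := N + ((1 - e)%:C)%C *: (A - N).

Lemma segment_dist A N e :
  frobenius2 (segment A N e - A) = e ^+ 2 * frobenius2 (A - N).
Proof.
rewrite (_ : segment A N e - A = (- e)%:C%C *: (A - N)).
  by rewrite frobenius2Z sqrrN.
have -> : ((- e)%:C)%C = - (e%:C)%C :> C by exact: rmorphN.
have eC : ((1 - e)%:C)%C = 1 - (e%:C)%C :> C by exact: rmorphB.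
rewrite /segment eC; apply/matrixP => i j; rewrite !mxE; ring.
Qed.

(** Moving [A] towards a nearest point [N] turns the defining inequality of
    nearest points into one with quadratic growth. *)
Lemma box_minimizer_growth p r A N e Y : box_minimizer p r A N -> 0 < e < 1 ->
  Y \is normalmx -> in_box p r Y ->
  frobenius2 (segment A N e - N) + e * frobenius2 (Y - N) <=
  frobenius2 (segment A N e - Y).
Proof.
move=> [nN bN minN] /andP[e0 e1] nY bY; have := minN Y nY bY.
have -> : A - Y = (A - N) - (Y - N) by rewrite opprB addrA subrK.
have -> : segment A N e - Y = ((1 - e)%:C)%C *: (A - N) - (Y - N).
  by rewrite /segment opprB addrCA addrA.
have -> : segment A N e - N = ((1 - e)%:C)%C *: (A - N).
  by rewrite /segment addrAC subrr add0r.
rewrite (frobenius2B (A - N)) (frobenius2B (_ *: _)) innerZl frobenius2Z.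
exact: shrink_growth.
Qed.

(** By quadratic growth, any matrix of the open segment from [A] to [N] will do. *)
Lemma box_minimizer_unique_near p r A N d : box_minimizer p r A N -> 0 < d ->
  exists2 A', frobenius2 (A' - A) < d &
    forall Y Y', box_minimizer p r A' Y -> box_minimizer p r A' Y' -> Y = Y'.
Proof.
move=> mN d0; have [e /andP[e0 e1] eF] := small_factor (frobenius2_ge0 (A - N)) d0.
exists (segment A N e).
  rewrite segment_dist; apply: le_lt_trans eF; rewrite ler_wpM2r ?frobenius2_ge0//.
  nra.
suff YN Y : box_minimizer p r (segment A N e) Y -> Y = N by move=> Y Y' /YN-> /YN.
move=> [nY bY minY]; have [nN bN _] := mN.
have g := box_minimizer_growth mN (e := e) _ nY bY.
have := g _; rewrite e0 e1 => /(_ isT) {}g.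
have := minY N nN bN => h.
apply/eqP; rewrite -subr_eq0; apply/eqP/frobenius2_eq0/eqP.
rewrite eq_le frobenius2_ge0 andbT -(pmulr_rle0 _ e0).
by rewrite -(lerD2l (frobenius2 (segment A N e - N))) addr0 (le_trans g h).
Qed.

End Boxes.

(** * Perturbation of eigenvalue clusters *)

Section Repeated.
Variables (R : realType) (n : nat).
Local Notation C := (Cfield R).
Local Notation M := 'M[C]_n.

Lemma normcB (x y : C) : normc (x - y) = normc (y - x).
Proof. by rewrite -normcN opprB. Qed.

Lemma normc_triangle (y x z : C) : normc (x - z) <= normc (x - y) + normc (y - z).
Proof. by have := le_normcD (x - y) (y - z); rewrite addrA subrK. Qed.

Definition count_values (d : 'rV[C]_n) := size (undup (codom (d 0))).

(** Eigenvalues that move by less than the spectral gap keep their clusters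
    apart; when moreover the number of distinct values does not increase, no
    cluster splits. *)
Lemma cluster (d d' : 'rV[C]_n) (a : 'I_n -> 'I_n -> R) (w g : R) (i : 'I_n) :
  (forall k l, 0 <= a k l) -> (forall k, \sum_l a k l = 1) ->
  (forall k, \sum_l a k l * normc (d' 0 l - d 0 k) ^+ 2 <= w) ->
  0 < g -> w < g ^+ 2 ->
  (forall k l, d 0 k != d 0 l -> 3 * g <= normc (d 0 k - d 0 l)) ->
  (count_values d' <= count_values d)%N ->
  exists2 m, normc (m - d 0 i) < g &
    forall l, d' 0 l = m \/ 2 * g <= normc (d' 0 l - d 0 i).
Proof.
move=> a0 a1 aw g0 wg sep cnt.
have near_value k : exists l, normc (d' 0 l - d 0 k) < g.
  apply: contrapT => nex; suff : g ^+ 2 <= w by rewrite leNgt wg.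
  apply: le_trans (aw k).
  rewrite -[leLHS]mul1r -(a1 k) mulr_suml; apply: ler_sum => l _.
  apply: ler_wpM2l => //; rewrite ler_pXn2r ?nnegrE ?normc_ge0 ?(ltW g0)//.
  by rewrite leNgt; apply/negP => lk; apply: nex; exists l.
have /choice[f fP] : forall x, exists y, x \in codom (d 0) ->
    y \in codom (d' 0) /\ normc (y - x) < g.
  move=> x; have [/codomP[k ->]|] := boolP (x \in codom (d 0)).
    by have [l lk] := near_value k; exists (d' 0 l) => _; rewrite codom_f.
  by move=> _; exists 0.
have sepx x y : x \in codom (d 0) -> y \in codom (d 0) -> x != y ->
    3 * g <= normc (x - y).
  by move=> /codomP[k ->] /codomP[l ->]; exact: sep.
have fsurj : map f (undup (codom (d 0))) =i undup (codom (d' 0)).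
  have /uniq_min_size : uniq (map f (undup (codom (d 0)))).
    rewrite map_inj_in_uniq ?undup_uniq// => x y; rewrite !mem_undup => xd yd fxy.
    apply/eqP; apply: contraT => xy; have := sepx _ _ xd yd xy.
    have [_ fx] := fP _ xd; have [_ fy] := fP _ yd; rewrite normcB fxy in fx.
    by have := normc_triangle (f y) x y; lra.
  case/(_ (undup (codom (d' 0)))) => //.
    move=> y /mapP[x]; rewrite !mem_undup => xd ->.
    by have [] := fP _ xd.
  by rewrite size_map.
have di : d 0 i \in codom (d 0) by exact: codom_f.
exists (f (d 0 i)); first by have [] := fP _ di.
move=> l; have : d' 0 l \in undup (codom (d' 0)) by rewrite mem_undup codom_f.
rewrite -fsurj => /mapP[x]; rewrite mem_undup => xd ->.
have [->|xi] := eqVneq x (d 0 i); first by left.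
right; have := sepx _ _ xd di xi; have [_ fx] := fP _ xd.
by rewrite normcB in fx; have := normc_triangle (f x) x (d 0 i); lra.
Qed.

Lemma ReC_conj_sandwich (g x : C) :
  complex.Re (g^* * x * g) = normc g ^+ 2 * complex.Re x.
Proof.
rewrite sqr_normcE; case: g x => a b [c d] /=; ring.
Qed.

Lemma normc_conj (z : C) : normc (z^*) = normc z.
Proof. by case: z => a b; rewrite /= sqrrN. Qed.

Lemma unitary_col_sum (G : M) k : G \is unitarymx ->
  \sum_l normc (G l k) ^+ 2 = 1.
Proof.
rewrite -trmxC_unitary => /unitarymxP/matrixP/(_ k k).
rewrite !mxE eqxx => /(congr1 (fun z : C => complex.Re z)) /=; rewrite ReC_sum => <-.
apply: eq_bigr => l _; rewrite !mxE conjCK ReC_conjM sqr_normcE.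
by rewrite !expr2.
Qed.

(** In an eigenbasis of a normal matrix, adding a multiple of this matrix moves
    two eigenvalues apart and preserves normality. *)
Definition spread (i j : 'I_n) : M := delta_mx i i - delta_mx j j.

Lemma inner_spread0 W i j :
  inner W (spread i j) = complex.Re (W i i) - complex.Re (W j j).
Proof.
have dE k (X : M) : inner X (delta_mx k k) = complex.Re (X k k).
  rewrite innerE (bigD1 k)//= (bigD1 k)//= !mxE !eqxx /= mulr1 mulr0 addr0.
  rewrite !big1 ?addr0// => l lk; last first.
    by rewrite mxE (negbTE lk) andbF /= !mulr0 addr0.
  by apply: big1 => m _; rewrite mxE (negbTE lk) /= !mulr0 addr0.
by rewrite /spread innerDr innerNr !dE.
Qed.

Lemma inner_spread (Q W : M) i j : inner W (Q^t* *m spread i j *m Q) =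
  complex.Re ((Q *m W *m Q^t*) i i) - complex.Re ((Q *m W *m Q^t*) j j).
Proof.
rewrite -inner_spread0 /inner !trmx_mul !map_mxM trmxCK !mulmxA mxtrace_mulC.
by rewrite !mulmxA.
Qed.

Lemma frobenius2_spread (Q : M) i j : Q \is unitarymx -> i != j ->
  frobenius2 (Q^t* *m spread i j *m Q) = 2.
Proof.
move=> uQ ij; rewrite frobenius2_unitaryr// frobenius2_unitaryl ?trmxC_unitary//.
rewrite frobenius2_inner inner_spread0 !mxE !eqxx (negbTE ij).
by rewrite eq_sym (negbTE ij) /= oppr0 addr0 add0r opprK.
Qed.

Lemma normal_unitary_diag (Q : M) (d : 'rV[C]_n) : Q \is unitarymx ->
  Q^t* *m diag_mx d *m Q \is normalmx.
Proof.
move=> uQ; apply/orthomx_spectral_subproof; exists (Q, d) => //=.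
by rewrite invmx_unitary.
Qed.

Lemma spread_diag i j : spread i j = diag_mx (delta_mx 0 i - delta_mx 0 j).
Proof.
have dE m : delta_mx m m = diag_mx (delta_mx 0 m) :> M.
  apply/matrixP => k l; rewrite !mxE eqxx /=.
  case: (eqVneq k l) => [->|kl]; rewrite ?andbb ?mulr1n ?mulr0n//.
  have [km|//] := eqVneq k m.
  by rewrite -km eq_sym (negbTE kl).
by rewrite /spread !dE linearB.
Qed.

Lemma normal_add_spread (Q : M) (d : 'rV[C]_n) (z : C) i j : Q \is unitarymx ->
  Q^t* *m diag_mx d *m Q + z *: (Q^t* *m spread i j *m Q) \is normalmx.
Proof.
move=> uQ; rewrite spread_diag scalemxAl scalemxAr -mulmxDl -mulmxDr -linearZ.
by rewrite -linearD; exact: normal_unitary_diag.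
Qed.

(** The diagonal entries of [Q *m N' *m Q^t*] are averages of the eigenvalues
    of [N'], with weights that are of second order in [N' - N] off the cluster
    of [d i]. Hence two diagonal entries belonging to one cluster that does not
    split differ by a second order term. *)
Lemma inner_spread_le (Q Q' : M) (d d' : 'rV[C]_n) (g : R) i j :
  let N := Q^t* *m diag_mx d *m Q in
  let N' := Q'^t* *m diag_mx d' *m Q' in
  Q \is unitarymx -> Q' \is unitarymx -> d 0 i = d 0 j ->
  0 < g -> frobenius2 (N' - N) < g ^+ 2 ->
  (forall k l, d 0 k != d 0 l -> 3 * g <= normc (d 0 k - d 0 l)) ->
  (count_values d' <= count_values d)%N ->
  inner (N' - N) (Q^t* *m spread i j *m Q) <=
    (4 * n%:R / g) * frobenius2 (N' - N).
Proof.
move=> N N' uQ uQ' dij g0 Wg sep cnt; set W := N' - N.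
have uQt : Q^t* \is unitarymx by rewrite trmxC_unitary.
pose G := Q' *m Q^t*; have uG : G \is unitarymx by exact: mul_unitarymx.
pose V := Q *m W *m Q^t*.
have VE : V = G^t* *m diag_mx d' *m G - diag_mx d.
  rewrite /V /W /G mulmxBr mulmxBl /N /N' trmx_mul map_mxM trmxCK !mulmxA.
  by rewrite (unitarymxP uQ) mul1mx mulmxtVK.
clearbody G.
pose a k l := normc (G l k) ^+ 2.
have a0 k l : 0 <= a k l by rewrite sqr_ge0.
have a1 k : \sum_l a k l = 1 by exact: unitary_col_sum.
have VG k l : normc ((V *m G^t*) k l) ^+ 2 = a k l * normc (d' 0 l - d 0 k) ^+ 2.
  rewrite VE mulmxBl mulmxtVK// !mxE.
  rewrite (bigD1 l)//= big1 ?addr0; last first.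
    by move=> m ml; rewrite !mxE (negbTE ml) mulr0n mulr0.
  rewrite (bigD1 k)//= big1 ?addr0; last first.
    by move=> m mk; rewrite !mxE eq_sym (negbTE mk) mulr0n mul0r.
  rewrite !mxE !eqxx !mulr1n (mulrC (d 0 k)) -mulrBr normcM exprMn.
  by rewrite normc_conj.
have aw k : \sum_l a k l * normc (d' 0 l - d 0 k) ^+ 2 <= frobenius2 W.
  have -> : frobenius2 W = frobenius2 (V *m G^t*).
    have uGt : G^t* \is unitarymx by rewrite trmxC_unitary.
    rewrite (frobenius2_unitaryr V uGt).
    by rewrite (frobenius2_unitaryr (Q *m W) uQt) frobenius2_unitaryl.
  rewrite -(eq_bigr _ (fun l _ => VG k l)) frobenius2_sum [leRHS](bigD1 k)//= lerDl.
  by do 2!apply: sumr_ge0 => ? _; rewrite sqr_ge0.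
have [m mi dm] := cluster i a0 a1 aw g0 Wg sep cnt.
have ReV k : complex.Re (V k k) =
    \sum_l a k l * complex.Re (d' 0 l - m) + complex.Re m - complex.Re (d 0 k).
  rewrite VE mul_mx_diag mxE [in X in _ + X]mxE [in X in _ + X]mxE eqxx mulr1n.
  rewrite ReCD ReCN mxE ReC_sum; congr (_ - _).
  rewrite -[X in _ + X]mul1r -(a1 k) mulr_suml -big_split /=; apply: eq_bigr => l _.
  by rewrite !mxE ReC_conj_sandwich -mulrDr ReCD ReCN subrK.
rewrite inner_spread -/V !ReV dij.
have w0 := frobenius2_ge0 W.
have aw1 k l : a k l * normc (d' 0 l - d 0 k) ^+ 2 <= frobenius2 W.
  apply: le_trans (aw k); rewrite (bigD1 l)//= lerDl; apply: sumr_ge0 => ? _.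
  by rewrite mulr_ge0// sqr_ge0.
have term k l : d 0 k = d 0 i ->
    `|a k l * complex.Re (d' 0 l - m)| <= (2 / g) * frobenius2 W.
  move=> ki; rewrite normrM (ger0_norm (a0 _ _)).
  apply: (@le_trans _ _ (a k l * normc (d' 0 l - m))).
    by apply: ler_wpM2l => //; exact: Re_le_normc.
  have [->|far] := dm l.
    by rewrite subrr normc0 mulr0 mulr_ge0// divr_ge0// ltW.
  apply: (weighted_le (x := normc (d' 0 l - d 0 i))) => //; last first.
    by rewrite -ki.
  apply: le_trans (normc_triangle (d 0 i) _ _) _.
  rewrite mulr2n mulrDl mul1r lerD2l (normcB _ m) (le_trans (ltW mi))//.
  by apply: le_trans far; rewrite ler_peMl ?ler1n// ltW.
have sum_le k : d 0 k = d 0 i ->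
    `|\sum_l a k l * complex.Re (d' 0 l - m)| <= n%:R * ((2 / g) * frobenius2 W).
  move=> ki; apply: le_trans (ler_norm_sum _ _ _) _.
  rewrite -[n in n%:R]card_ord mulr_natl -sumr_const; apply: ler_sum => l _.
  exact: term.
have := sum_le i erefl; have := sum_le j (esym dij).
have -> : 4 * n%:R / g * frobenius2 W = 2 * (n%:R * (2 / g * frobenius2 W)).
  by field; rewrite gt_eqF.
by move=> yz xz; exact: norm_sub_le.
Qed.

End Repeated.

Arguments spread {R n} i j.

(** * Nearest points with a repeated eigenvalue *)

Section NoOpen.
Variables (R : realType) (n : nat).
Local Notation C := (Cfield R).
Local Notation M := 'M[C]_n.

Definition repeated_minimizer (p : M) (r : R) (i j : 'I_n) (A Q : M)
    (d : 'rV[C]_n) :=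
  [/\ Q \is unitarymx, d 0 i = d 0 j &
      box_minimizer p r A (Q^t* *m diag_mx d *m Q)].

(** First order condition for moving two eigenvalues of the nearest point in
    opposite directions, which can be done with both signs. *)
Lemma minimizer_orthogonal p r A (Q : M) (d : 'rV[C]_n) (i j : 'I_n) :
  Q \is unitarymx -> i != j -> box_minimizer p r A (Q^t* *m diag_mx d *m Q) ->
  inner (A - Q^t* *m diag_mx d *m Q) (Q^t* *m spread i j *m Q) = 0.
Proof.
move=> uQ ij [nN bN minN]; set N := Q^t* *m _ *m Q in nN bN minN *.
set H := Q^t* *m _ *m Q; have H2 : frobenius2 H = 2 by exact: frobenius2_spread.
have [e e0 box_e] := in_box_open bN.
apply/eqP; apply: contraT => x0; set x := inner _ _ in x0.
have m0 : 0 < Num.min e (2 * `|x|) by rewrite lt_min e0 mulr_gt0 ?normr_gt0.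
have [t /andP[t0 t1]] := small_factor (ler0n R 2) m0.
rewrite lt_min => /andP[te tx].
pose a := t * Num.sg x; have a2 : a ^+ 2 = t ^+ 2.
  by rewrite exprMn sqr_sg x0 mulr1.
have : frobenius2 (A - N) <= frobenius2 (A - (N + (a%:C)%C *: H)).
  apply: minN; first exact: normal_add_spread.
  apply: box_e; rewrite addrAC subrr add0r frobenius2Z H2 a2 expr2.
  by apply: le_lt_trans te; nra.
rewrite opprD addrA (frobenius2B (A - N)) innerZr frobenius2Z H2 -/x a2.
have -> : a * x = t * `|x| by rewrite /a -mulrA -normrEsg.
by move/(linear_beats_square t0 tx).
Qed.

(** The factor 3 leaves a distance of [2 * g] between an eigenvalue and a
    perturbation by at most [g] of a different one. *)
Lemma eigenvalue_gap (d : 'rV[C]_n) : exists2 g : R, 0 < g &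
  forall k l, d 0 k != d 0 l -> 3 * g <= normc (d 0 k - d 0 l).
Proof.
pose g := \big[Num.min/1]_(k < n) \big[Num.min/1]_(l < n | d 0 k != d 0 l)
  normc (d 0 k - d 0 l).
have g0 : 0 < g.
  rewrite /g lt_bigmin// => k _; rewrite lt_bigmin// => l kl.
  rewrite lt_neqAle normc_ge0 andbT eq_sym; apply: contraNneq kl => /eq0_normc.
  by move=> /eqP; rewrite subr_eq0.
exists (g / 3); first by rewrite divr_gt0.
move=> k l kl; rewrite mulrC divfK ?pnatr_eq0//.
by apply: le_trans (bigmin_le _ k _) _; rewrite ?bigmin_le_cond.
Qed.

Lemma count_values_le (d : 'rV[C]_n) : (count_values d <= n)%N.
Proof. by rewrite (leq_trans (size_undup _))// size_codom card_ord. Qed.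

(** Suppose the set contained a ball. Choose in it a nearest point with the
    largest possible number of distinct eigenvalues, and move [A] towards that
    nearest point, so that nearest points depend on [A] in a Lipschitz way.
    Adding to [A] a small matrix [H] that would separate two coinciding
    eigenvalues must then displace the nearest point by at least about [H] in
    the direction of [H], but by maximality the cluster cannot split, which
    makes that displacement quadratically small. *)
Lemma no_open_repeated p r (i j : 'I_n) A0 (delta : R) : i != j -> 0 < delta ->
  ~ (forall A, in_box A0 delta A -> exists Q d, repeated_minimizer p r i j A Q d).
Proof.
move=> ij delta0 all_rep.
pose attained c := `[< exists A Q d, [/\ in_box A0 delta A,
  repeated_minimizer p r i j A Q d & count_values d = c] >].
have ex_att : exists c, attained c.
  have [|Q [d QdP]] := all_rep A0.
    by move=> k l; rewrite subrr mxE /= normr0.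
  exists (count_values d); apply/asboolP; exists A0, Q, d; split=> // k l.
  by rewrite subrr mxE /= normr0.
have att_le c : attained c -> (c <= n)%N.
  by move=> /asboolP[A [Q [d [_ _ <-]]]]; exact: count_values_le.
have [c /asboolP[A [Q [d [bA [uQ dij mN] dc]]]] maxc] := ex_maxnP ex_att att_le.
have {}maxc A' Q' d' : in_box A0 delta A' -> repeated_minimizer p r i j A' Q' d' ->
    (count_values d' <= count_values d)%N.
  by move=> bA' mA'; rewrite dc; apply: maxc; apply/asboolP; exists A', Q', d'.
have DH := minimizer_orthogonal uQ ij mN.
have [nN bN _] := mN; set N := Q^t* *m _ *m Q in mN DH nN bN.
set H := Q^t* *m _ *m Q in DH.
have H2 : frobenius2 H = 2 by exact: frobenius2_spread.
have [d1 d10 box1] := in_box_open bA.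
have [e e01 eF] := small_factor (frobenius2_ge0 (A - N)) d10.
have /andP[e0 e1] := e01.
pose As := segment A N e.
have bAs : in_box A0 delta As.
  apply: box1; rewrite segment_dist; apply: le_lt_trans eF.
  rewrite ler_wpM2r ?frobenius2_ge0// expr2 ger_pMl//; exact: ltW.
have [d2 d20 box2] := in_box_open bAs.
have [d3 d30 box3] := in_box_open bN.
have [g g0 sep] := eigenvalue_gap d.
have n0 : 1 <= n%:R :> R by rewrite ler1n (leq_ltn_trans _ (ltn_ord i)).
(* The summand 2 keeps the perturbed matrices in their boxes; 8 n / g is twice
   the constant of the second order bound [inner_spread_le]. *)
have c0 : 0 <= 8 * n%:R / g + 2 :> R.
  by rewrite addr_ge0// divr_ge0 ?(ltW g0)// mulr_ge0.
have m0 : 0 < Num.min e (Num.min d2 d3) by rewrite !lt_min e0 d20.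
have [t /andP[t0 t1]] := small_factor c0 m0.
rewrite !lt_min mulrDr => /and3P[te td2 td3].
have sg0 : 0 <= t * (8 * n%:R / g).
  by rewrite mulr_ge0 ?(ltW t0)// divr_ge0 ?(ltW g0)// mulr_ge0.
have tt2 : t ^+ 2 * 2 <= t * 2 by rewrite ler_wpM2r// expr2 ger_pMl// ltW.
have {}te : t * (8 * n%:R / g) < e.
  by apply: le_lt_trans te; rewrite lerDl mulr_ge0// ltW.
have {}td2 : t ^+ 2 * 2 < d2.
  by apply: le_lt_trans td2; apply: le_trans tt2 _; rewrite lerDr.
have {}td3 : t ^+ 2 * 2 < d3.
  by apply: le_lt_trans td3; apply: le_trans tt2 _; rewrite lerDr.
have tg : t * 8 < e * g.
  move: te; rewrite mulrA ltr_pdivrMr// => te; apply: le_lt_trans te.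
  by rewrite mulrA ler_peMr// mulr_ge0// ltW.
pose Ht := (t%:C)%C *: H; pose A' := As + Ht.
have Ht2 : frobenius2 Ht = t ^+ 2 * 2 by rewrite frobenius2Z H2.
have bA' : in_box A0 delta A'.
  by apply: box2; rewrite /A' addrAC subrr add0r Ht2.
have [Q' [d' rep']] := all_rep A' bA'.
have cnt := maxc _ _ _ bA' rep'; have [uQ' _ mN'] := rep'.
have Wle := inner_spread_le (i := i) (j := j) uQ uQ' dij g0 _ sep cnt.
set N' := Q'^t* *m _ *m Q' in mN' Wle; have [nN' bN' minN'] := mN'.
rewrite -/N -/H in Wle; set W := N' - N in Wle.
have subD (X Y Z : M) : (X + Z) - (Y + Z) = X - Y.
  by rewrite opprD addrACA subrr addr0.
(* [N + Ht] competes with [N'] for the perturbed matrix, and [N'] competes with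
   [N] for the unperturbed one. *)
have key : frobenius2 Ht + e * frobenius2 W <= 2 * inner W Ht.
  have : frobenius2 (A' - N') <= frobenius2 (A' - (N + Ht)).
    apply: minN'; first exact: normal_add_spread.
    by apply: box3; rewrite addrAC subrr add0r Ht2.
  have -> : A' - (N + Ht) = As - N by exact: subD.
  have E : A' - N' = (As - N') + Ht by exact: addrAC.
  rewrite [X in frobenius2 X <= _]E.
  have := box_minimizer_growth mN e01 nN' bN'; rewrite -/As -/W.
  rewrite (frobenius2D (As - N')).
  have -> : inner (As - N') Ht = - inner W Ht.
    have -> : As - N' = ((1 - e)%:C)%C *: (A - N) - W.
      by rewrite /As /segment /W opprB addrCA addrA.
    by rewrite innerDl innerNl innerZl /Ht innerZr DH !mulr0 add0r.
  by apply: growth_combine.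
have w0 := frobenius2_ge0 W.
have Wg : frobenius2 W < g ^+ 2.
  have := frobenius2_ge0 (((e / 2)%:C)%C *: W - Ht).
  rewrite frobenius2B frobenius2Z innerZl.
  exact: (displacement_bound e0 g0 t0 Ht2 tg key).
have := Wle Wg; rewrite leNgt => /negP; apply.
rewrite Ht2 /Ht innerZr in key.
exact: (displacement_contra g0 t0 w0 te key).
Qed.

End NoOpen.

(** * Topology of the flag manifold *)

Lemma local_minimizer_comp (T U : topologicalType) (d : Order.disp_t)
    (K : porderType d) (g : T -> U) (F : U -> K) (D : set U) (x : T) :
  continuous g -> (forall y, D (g y)) -> local_minimizer_on D F (g x) ->
  local_minimizer (F \o g) x.
Proof.
move=> cg Dg [_ minF]; have := cg _ _ minF.
by apply: (@filterS _ _ (nbhs_filter x)) => y; exact.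
Qed.

Section MatrixTopology.
Variables (R : realType) (n : nat).
Local Notation C := (Cfield R).
Local Notation M := 'M[C]_n.

Lemma normE (z : C) : `|z| = ((normc z)%:C)%C :> C.
Proof. by case: z. Qed.

Lemma normc_le_ReIm (z : C) : normc z <= `|complex.Re z| + `|complex.Im z|.
Proof.
rewrite -(@ler_pXn2r _ 2) ?nnegrE ?normc_ge0 ?addr_ge0// sqr_normcE sqrrD.
rewrite !real_normK ?num_real// lerD2r lerDl mulrn_wge0// mulr_ge0//.
Qed.

Lemma nbhs_matrix_box (N : M) (S : set M) :
  nbhs N S <-> exists2 r : R, 0 < r & forall X, in_box N r X -> S X.
Proof.
split=> [/nbhs_ballP[e /= e0 eS]|[r r0 rS]].
  have eE : e = ((complex.Re e)%:C)%C.
    by move: e0; rewrite ltcE /= => /andP[/eqP]; case: e {eS} => a b /= -> _.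
  have r0 : 0 < complex.Re e by move: e0; rewrite eE ltcR.
  exists (complex.Re e / 2); first by rewrite divr_gt0.
  move=> X bX; apply: eS; split=> // i j; rewrite -ball_normE /ball_ /=.
  rewrite normE eE ltcR normcB; have [] := bX i j; rewrite !mxE.
  have := normc_le_ReIm (X i j - N i j); lra.
apply/nbhs_ballP; exists ((r%:C)%C : C) => /=; first by rewrite ltcR.
move=> X [_ bX]; apply: rS => i j; have := bX i j.
rewrite -ball_normE /ball_ /= normE ltcR normcB !mxE => h.
by split; apply: le_lt_trans h; [exact: Re_le_normc|exact: Im_le_normc].
Qed.

Lemma local_minimizer_boxP (A N : M) :
  local_minimizer_on normal_matrices (fun X => frobenius2 (A - X)) N <->
  exists2 r : R, 0 < r & box_minimizer N r A N.
Proof.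
split=> [[nN /nbhs_matrix_box[r r0 rS]]|[r r0 [nN _ minN]]].
  exists r; first exact: r0.
  split; [exact: nN | | by move=> X nX bX; exact: rS].
  by move=> i j; rewrite subrr mxE normr0.
split; first exact: nN.
apply/nbhs_matrix_box; exists r; first exact: r0.
by move=> X bX nX; exact: minN.
Qed.

Lemma matrix_continuous (T : topologicalType) (f : T -> M) :
  (forall i j, continuous (fun x => f x i j : C)) -> continuous f.
Proof.
move=> cf x S [P nP PS].
have : \forall y \near x, forall i j, P i j (f y i j).
  by apply: filter_forall => i; apply: filter_forall => j; apply: cf; exact: nP.
by apply: filterS => y Py; exact: PS.
Qed.

Lemma mulmx_continuous (T : topologicalType) (f g : T -> M) :
  continuous f -> continuous g -> continuous (fun x => f x *m g x).
Proof.
move=> cf cg; apply: matrix_continuous => i j.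
rewrite (_ : (fun _ => _) = (fun x => \sum_k f x i k * g x k j)); last first.
  by apply/funext => x; rewrite mxE.
apply: continuous_big => [|k _ x]; first exact: add_continuous.
apply: cvgM.
  exact: (cvg_comp _ _ (cf x) (@coord_continuous C n n i k (f x))).
exact: (cvg_comp _ _ (cg x) (@coord_continuous C n n k j (g x))).
Qed.

Lemma adj_continuous (T : topologicalType) (f : T -> M) :
  continuous f -> continuous (fun x => (f x)^t*).
Proof.
move=> cf; apply: matrix_continuous => i j.
rewrite (_ : (fun _ => _) = (fun x => (f x j i)^*)); last first.
  by apply/funext => x; rewrite !mxE.
have cc : continuous (fun z : C => z^*).
  move=> z S /nbhs_ballP[e e0 eS]; apply/nbhs_ballP; exists e => // w zw.
  by apply: eS; move: zw; rewrite -!ball_normE /ball_ /= -rmorphB norm_conjC.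
move=> x; apply: (@continuous_comp _ _ _ (fun x => f x j i) _ _ _ (cc _)).
exact: (cvg_comp _ _ (cf x) (@coord_continuous C n n j i (f x))).
Qed.

Lemma diag_part_continuous (T : topologicalType) (f : T -> M) :
  continuous f -> continuous (fun x => diag_part (f x)).
Proof.
move=> cf; apply: matrix_continuous => i j.
rewrite (_ : (fun _ => _) = (fun x => f x i i *+ (i == j))); last first.
  by apply/funext => x; rewrite !mxE.
move=> x; case: (i == j); last exact: cvg_cst.
exact: (cvg_comp _ _ (cf x) (@coord_continuous C n n i i (f x))).
Qed.

Lemma N_flag_continuous (A : M) : continuous (@N_flag R n A).
Proof.
have := @repr_comp_continuous _ {eq_quot (@flag_equiv R n)} _ (@N_unitary R n A).
apply=> [|P Q /eqP PQ]; last first.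
  apply/eqP/N_unitary_flag/flag_relP/flag_classP/eqP; exact: PQ.
have cv : continuous (fun Q : @unitary_group R n => \val Q).
  exact: initial_continuous.

have cA : continuous (fun _ : @unitary_group R n => A)
  by exact: cst_continuous.
have cB := mulmx_continuous (mulmx_continuous (adj_continuous cv) cA) cv.
exact: (mulmx_continuous (mulmx_continuous cv (diag_part_continuous cB))
  (adj_continuous cv)).
Qed.

Lemma unitary_val (Q : @unitary_group R n) : \val Q \is unitarymx.
Proof. by have := set_valP Q. Qed.

(** By unitary invariance of the norm, the off-diagonal part measures the
    distance from [A] to the normal matrix obtained by deleting it. *)
Lemma f_unitaryE (A : M) Q : f_unitary A Q = frobenius2 (A - N_unitary A Q).
Proof.
have uQ := unitary_val Q.
rewrite /f_unitary /offdiag; set B := _ *m _ *m \val Q.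
have -> : A - N_unitary A Q = \val Q *m (B - diag_part B) *m (\val Q)^t*.
  rewrite mulmxBr mulmxBl /N_unitary -/B /B !mulmxA mulmxtVK//.
  by rewrite (unitarymxP uQ) mul1mx.
have uQt : (\val Q)^t* \is unitarymx by rewrite trmxC_unitary.
by rewrite (frobenius2_unitaryr _ uQt) (frobenius2_unitaryl _ uQ).
Qed.

Lemma N_unitary_normal (A : M) Q : N_unitary A Q \is normalmx.
Proof.
have uQt : (\val Q)^t* \is unitarymx by rewrite trmxC_unitary; exact: unitary_val.
by have := normal_unitary_diag (\row_i ((\val Q)^t* *m A *m \val Q) i i) uQt;
   rewrite trmxCK.
Qed.

Lemma local_minimizer_f_flag (A N0 : M) (q : flag_manifold R n) :
  local_minimizer_on normal_matrices (fun X => frobenius2 (A - X)) N0 ->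
  N_flag A q = N0 -> local_minimizer (f_flag A) q.
Proof.
move=> minN qN; rewrite -qN in minN.
have := local_minimizer_comp (@N_flag_continuous A) _ minN.
rewrite (_ : _ \o _ = f_flag A).
  by apply=> y; exact: N_unitary_normal.
by apply/funext => y; rewrite /f_flag f_unitaryE.
Qed.

End MatrixTopology.

(** * The fibre of the flag manifold over a nearest point *)

Section FlagFiber.
Variables (R : realType) (n : nat).
Local Notation C := (Cfield R).
Local Notation M := 'M[C]_n.

Lemma inner_unitary_conj (Q X Y : M) : Q \is unitarymx ->
  inner (Q *m X *m Q^t*) (Q *m Y *m Q^t*) = inner X Y.
Proof.
move=> uQ; rewrite /inner !trmx_mul !map_mxM trmxCK !mulmxA mulmxKtV//.
have uQt : Q^t* \is unitarymx by rewrite trmxC_unitary.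
rewrite mxtrace_mulC !mulmxA.
by have := unitarymxP uQt; rewrite trmxCK => ->; rewrite mul1mx.
Qed.

Lemma inner_diag_part (X : M) : inner X (diag_part X) = frobenius2 (diag_part X).
Proof.
rewrite frobenius2_inner !innerE; apply: eq_bigr => i _; apply: eq_bigr => j _.
by rewrite !mxE; case: eqVneq => [->//|_]; rewrite /= !mulr0.
Qed.

(** A nearest point minimizes in particular over the matrices with the same
    eigenvectors, where the best eigenvalues are the diagonal entries of
    [Q^t* *m A *m Q]. *)
Lemma minimizer_diag p r (A Q : M) (d : 'rV[C]_n) : Q \is unitarymx ->
  box_minimizer p r A (Q *m diag_mx d *m Q^t*) ->
  Q *m diag_part (Q^t* *m A *m Q) *m Q^t* = Q *m diag_mx d *m Q^t*.
Proof.
move=> uQ [_ bN minN]; set N := Q *m diag_mx d *m _ in bN minN *.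
set B := Q^t* *m A *m Q; have uQt : Q^t* \is unitarymx by rewrite trmxC_unitary.
pose Z := Q *m diag_part (B - diag_mx d) *m Q^t*.
have dd : diag_part (B - diag_mx d) = diag_part B - diag_mx d.
  apply/matrixP => i j; rewrite !mxE eqxx mulr1n.
  by case: eqP => // _; rewrite subr0.
have ZE : Z = Q *m diag_part B *m Q^t* - N by rewrite /Z dd mulmxBr mulmxBl.
have AN : A - N = Q *m (B - diag_mx d) *m Q^t*.
  by rewrite mulmxBr mulmxBl /B !mulmxA (unitarymxP uQ) mul1mx mulmxtVK.
have ANZ : inner (A - N) Z = frobenius2 Z.
  rewrite AN /Z (inner_unitary_conj _ _ uQ) inner_diag_part.
  by rewrite (frobenius2_unitaryr _ uQt) (frobenius2_unitaryl _ uQ).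
have [e e0 box_e] := in_box_open bN.
have Z0 := frobenius2_ge0 Z.
have [t /andP[t0 t1] te] := small_factor Z0 e0.
have : frobenius2 (A - N) <= frobenius2 (A - (N + (t%:C)%C *: Z)).
  apply: minN.
    rewrite (_ : _ + _ = (Q^t*)^t* *m diag_mx
      (d + (t%:C)%C *: ((\row_i B i i) - d)) *m Q^t*).
      exact: normal_unitary_diag.
    rewrite trmxCK linearD linearZ linearB /= -dd mulmxDr mulmxDl.
    by rewrite -scalemxAr -scalemxAl.
  apply: box_e; rewrite addrAC subrr add0r frobenius2Z.
  have tt1 : t ^+ 2 <= t by rewrite expr2 ger_pMl// ltW.
  exact: le_lt_trans (ler_wpM2r Z0 tt1) te.
rewrite opprD addrA (frobenius2B (A - N)) innerZr frobenius2Z ANZ.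
move=> /(small_step_nonpos t0 t1) Zle; apply/eqP; rewrite -subr_eq0 -ZE; apply/eqP.
by apply: frobenius2_eq0; apply/eqP; rewrite eq_le Z0 Zle.
Qed.

Lemma N_unitary_eigenbasis (A N0 : M) (U : @unitary_group R n) (d : 'rV[C]_n) :
  local_minimizer_on normal_matrices (fun X => frobenius2 (A - X)) N0 ->
  N0 = \val U *m diag_mx d *m (\val U)^t* -> N_unitary A U = N0.
Proof.
move=> /local_minimizer_boxP[r r0 minr] N0E; have uU := unitary_val U.
have minr' : box_minimizer N0 r A (\val U *m diag_mx d *m (\val U)^t*).
  by rewrite -N0E.
by rewrite N0E; exact: (minimizer_diag uU minr').
Qed.

Lemma perm_mx_unitary (s : 'S_n) : (perm_mx s : M) \is unitarymx.
Proof.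
by apply/unitarymxP; rewrite tr_perm_mx map_perm_mx -perm_mxM mulgV perm_mx1.
Qed.

Lemma diag_perm_mx (d : 'rV[C]_n) (s : 'S_n) :
  diag_mx d *m perm_mx s = perm_mx s *m diag_mx (col_perm s^-1 d).
Proof.
apply/matrixP => i j; rewrite mul_diag_mx mul_mx_diag !mxE.
by case: eqP => [<-|_]; rewrite ?mulr0 ?mul0r// mulr1 mul1r permK.
Qed.

(** The unitary eigenbases of a normal matrix with distinct eigenvalues differ
    by the order of the eigenvectors and by their phases. *)
Lemma unitary_monomial (W : M) (d e : 'rV[C]_n) : W \is unitarymx ->
  injective (d 0) -> diag_mx d *m W = W *m diag_mx e ->
  exists (s : 'S_n) (D : M), diag_unitary D /\ W = perm_mx s *m D.
Proof.
move=> uW injd /matrixP dW.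
have {}dW i j : W i j != 0 -> d 0 i = e 0 j.
  move=> W0; have := dW i j; rewrite mul_diag_mx mul_mx_diag !mxE mulrC.
  exact: mulfI.
have /choice[f fP] : forall i, exists j, W i j != 0.
  move=> i; apply/existsP; apply: contraT; rewrite negb_exists => /forallP W0.
  have /matrixP/(_ i i) := unitarymxP uW; rewrite !mxE eqxx big1.
    by move/eqP; rewrite eq_sym oner_eq0.
  by move=> j _; have := W0 j; rewrite negbK => /eqP ->; rewrite mul0r.
have injf : injective f.
  by move=> i j fij; apply: injd; rewrite (dW _ _ (fP i)) (dW _ _ (fP j)) fij.
(* The nonzero entries of [W] lie on the graph of [s]. *)
pose s := perm injf.
have Ws i j : W i j != 0 -> j = s i.
  move=> Wij; rewrite -[j](permKV s); congr (s _); apply: injd.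
  rewrite (dW _ _ Wij) (dW _ _ (fP (s^-1%g j))).
  by rewrite -[f _](permE injf) permKV.
exists s, (perm_mx s^-1 *m W); split; last first.
  by rewrite mulmxA -perm_mxM mulgV perm_mx1 mul1mx.
split; last by rewrite mul_unitarymx ?perm_mx_unitary.
apply/is_diag_mxP => i j ij; apply/eqP; apply: contraNT ij.
rewrite -row_permE mxE => /Ws ->; by rewrite permKV.
Qed.

Variables (A N0 P : M) (d : 'rV[C]_n).
Hypothesis uP : P \is unitarymx.
Hypothesis N0E : N0 = P^t* *m diag_mx d *m P.
Hypothesis injd : injective (d 0).
Hypothesis minN0 :
  local_minimizer_on normal_matrices (fun X => frobenius2 (A - X)) N0.

Let basis_unitary (s : 'S_n) : P^t* *m perm_mx s \is unitarymx.
Proof. by rewrite mul_unitarymx ?perm_mx_unitary ?trmxC_unitary. Qed.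

Let basis (s : 'S_n) : @unitary_group R n :=
  SigSub (mem_set (basis_unitary s) : _ \in @unitary_group R n).

Let basis_N s : N_unitary A (basis s) = N0.
Proof.
apply: (N_unitary_eigenbasis (d := col_perm s^-1 d) minN0).
rewrite /= trmx_mul map_mxM trmxCK -[_ *m perm_mx s *m _]mulmxA -diag_perm_mx.
rewrite !mulmxA -[_ *m perm_mx s *m _]mulmxA.
by rewrite (unitarymxP (perm_mx_unitary s)) mulmx1.
Qed.

Lemma card_flag_fiber :
  [set q : flag_manifold R n |
     local_minimizer (f_flag A) q /\ N_flag A q = N0] #= `I_(n`!).
Proof.
pose F s : flag_manifold R n := flag_class (basis s).
have -> : [set q | local_minimizer (f_flag A) q /\ N_flag A q = N0] =
    F @` [set: 'S_n].
  apply/seteqP; split=> [q [_ qN]|_ [s _ <-]]; last first.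
    have FN : N_flag A (F s) = N0 by rewrite N_flagE basis_N.
    by split=> //; exact: local_minimizer_f_flag FN.
  have uQ := unitary_val (flag_repr q).
  set V := \val (flag_repr q) in uQ.
  pose e : 'rV[C]_n := \row_i (V^t* *m A *m V) i i.
  have VN : V *m diag_mx e *m V^t* = P^t* *m diag_mx d *m P by rewrite -N0E -qN.
  have PVe : diag_mx d *m (P *m V) = P *m V *m diag_mx e.
    have : P *m (V *m diag_mx e *m V^t*) *m V = P *m V *m diag_mx e.
      by rewrite !mulmxA mulmxKtV.
    by rewrite VN => <-; rewrite !mulmxA (unitarymxP uP) mul1mx.
  have [s [D [uD WE]]] := unitary_monomial (mul_unitarymx uP uQ) injd PVe.
  exists s => //; rewrite -[RHS]flag_reprK; apply/eqP/flag_classP.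
  exists D => //; rewrite /= -mulmxA -WE mulmxA.
  have uPt : P^t* \is unitarymx by rewrite trmxC_unitary.
  by have := unitarymxP uPt; rewrite trmxCK => ->; rewrite mul1mx.
have injF : injective F.
  move=> s s' /eqP/flag_classP[D [/is_diag_mxP dD _]] /= /(congr1 (mulmx P)).
  rewrite !mulmxA (unitarymxP uP) !mul1mx => /matrixP E.
  apply/permP => i; apply/eqP; rewrite eq_sym; apply: contraT => ss'.
  have := E i (s' i); rewrite -row_permE !mxE eqxx dD//; last by rewrite eq_sym.
  by move/eqP; rewrite oner_eq0.
apply: card_eq_trans (inj_card_eq _) _; first by move=> ? ? _ _; exact: injF.
have rankT : @enum_rank 'S_n @` [set: 'S_n] = setT.
  by apply/seteqP; split=> // k _; exists (enum_val k); rewrite ?enum_valK.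
rewrite -card_Sn; apply: card_eq_trans (card_esym card_II).
by rewrite -rankT; apply/card_esym/inj_card_eq => ? ? _ _; exact: enum_rank_inj.
Qed.

End FlagFiber.

(** * Generic matrices *)

Lemma ae_forall_countType d (T : measurableType d) (R : realType)
    (mu : {measure set T -> \bar R}) (I : countType) (P : I -> T -> Prop) :
  (forall i, {ae mu, forall t, P i t}) -> {ae mu, forall t, forall i, P i t}.
Proof.
move=> aeP; have : {ae mu, forall t, forall k i,
    @choice.unpickle I k = Some i -> P i t}.
  apply: ae_foralln => k; case kE: (@choice.unpickle I k) => [i|].
    by apply: filterS (aeP i) => t Pt _ [<-].
  by apply: nearW.
by apply: filterS => t Pt i; apply: (Pt (choice.pickle i)); exact: choice.pickleK.
Qed.

Section Generic.
Variables (R : realType) (n : nat).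
Local Notation C := (Cfield R).
Local Notation M := 'M[C]_n.
Local Notation dim := (n * n + n * n)%N.

Lemma block_tuple (t : dim.-tuple R) : block n t 0 = complex_matrix t.
Proof.
rewrite /block; congr complex_matrix; apply: eq_from_tnth => k.
by rewrite tnth_mktuple (tnth_nth 0).
Qed.

Lemma in_box_complex_matrix (u v : dim.-tuple R) d :
  in_box (complex_matrix u) d (complex_matrix v) ->
  forall k, `|tnth v k - tnth u k| < d.
Proof.
move=> box k; rewrite -(splitK k); case: (fintype.split k) => l /=;
  case/mxvec_indexP: l => i j; have := box i j; rewrite !mxE /=; case => //.
Qed.

Lemma definable_matrix_negligible (P : M -> Prop) :
  matrix_definable (fun B : nat -> M => P (B 0%N)) ->
  (forall A (d : R), 0 < d -> P A -> exists2 A', in_box A d A' & ~ P A') ->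
  (lebesgue_tuple R dim).-negligible [set t | P (complex_matrix t)].
Proof.
move=> dP noint.
rewrite (_ : [set t | _] = [set t : dim.-tuple R | P (block n t 0%N)]); last first.
  by apply/seteqP; split=> t /=; rewrite block_tuple.
apply: definable_negligible dP _ => u d d0; rewrite block_tuple => Pu.
have [A' bA' nPA'] := noint _ _ d0 Pu.
have [g gK Kg] := complex_matrix_bij R n.
exists (g A'); last by rewrite block_tuple Kg.
by apply: in_box_complex_matrix; rewrite Kg.
Qed.

Definition two_minimizers (p : M) (r : R) (A : M) := exists N N',
  [/\ box_minimizer p r A N, box_minimizer p r A N' & N <> N'].

Lemma two_minimizers_negligible p r :
  (lebesgue_tuple R dim).-negligible
    [set t | two_minimizers p r (complex_matrix t)].
Proof.
apply: definable_matrix_negligible => [|A d d0 [N [N' [mN _ _]]]]; last first.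
  have bA : in_box A d A by move=> i j; rewrite subrr mxE normr0.
  have [e e0 box_e] := in_box_open bA.
  have [A' AA' uniq_A'] := box_minimizer_unique_near mN e0.
  exists A'; first exact: box_e.
  by move=> [Y [Y' [mY mY' YY']]]; apply: YY'; exact: uniq_A'.
apply: (@matrix_definable_exists R n 1 (fun B N => exists N' : M,
  [/\ box_minimizer p r (B 0%N) N, box_minimizer p r (B 0%N) N' & N <> N'])) => //.
apply: (@matrix_definable_exists R n 2 (fun B N' =>
  [/\ box_minimizer p r (B 0%N) (B 1%N), box_minimizer p r (B 0%N) N' & B 1%N <> N'])) => //.
rewrite /matrix_definable (_ : (fun _ => _) = (fun e =>
    box_minimizer p r (block n e 0) (block n e 1) /\
    (box_minimizer p r (block n e 0) (block n e 2) /\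
     ~ block n e 1 = block n e 2))); last first.
  by apply/funext => e; rewrite propeqE; split=> [[]|[? []]].
have mp := @matrix_poly_cst R n p; have pr : real_poly (fun _ : nat -> M => r).
  exact: termfun_cst.
have mv := @matrix_poly_var R n.
apply: definable_and.
  by apply: (matrix_definable_minimizer (b := 3) mp pr (mv 0%N) (mv 1%N)).
apply: definable_and.
  by apply: (matrix_definable_minimizer (b := 3) mp pr (mv 0%N) (mv 2%N)).
exact/definable_not/(matrix_definable_eq (mv 1%N) (mv 2%N)).
Qed.

Lemma repeated_minimizer_negligible p r (i j : 'I_n) : i != j ->
  (lebesgue_tuple R dim).-negligible
    [set t | exists Q d, repeated_minimizer p r i j (complex_matrix t) Q d].
Proof.
move=> ij; apply: (definable_matrix_negligible
  (P := fun A => exists Q d, repeated_minimizer p r i j A Q d)); last first.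
  move=> A d d0 _; apply: contrapT => all_bad; apply: (no_open_repeated ij d0).
  move=> A' bA'; apply: contrapT => nA'; apply: all_bad.
  by exists A'; [exact: bA'|exact: nA'].
(* The eigenvalues are encoded as the diagonal of a matrix variable. *)
rewrite (_ : (fun _ => _) = (fun B : nat -> M => exists Q : M, exists D : M,
    Q *m Q^t* = 1%:M /\ (D i i = D j j /\
    box_minimizer p r (B 0%N) (Q^t* *m diag_part D *m Q)))); last first.
  apply/funext => B; rewrite propeqE; split=> [[Q [d [/unitarymxP uQ dij mN]]]|].
    exists Q, (diag_mx d); split; [exact: uQ|split].
      by rewrite !mxE !eqxx.
    by rewrite (_ : diag_part (diag_mx d) = diag_mx d)//; apply/matrixP => k l;
      rewrite !mxE eqxx mulr1n.
  move=> [Q [D [uQ [Dij mN]]]]; exists Q, (\row_k D k k).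
  by split; [exact/unitarymxP|rewrite !mxE|].
apply: (@matrix_definable_exists R n 1 (fun B (Q : M) => exists D : M,
    Q *m Q^t* = 1%:M /\ (D i i = D j j /\
    box_minimizer p r (B 0%N) (Q^t* *m diag_part D *m Q)))) => //.
apply: (@matrix_definable_exists R n 2 (fun B (D : M) =>
    B 1%N *m (B 1%N)^t* = 1%:M /\ (D i i = D j j /\
    box_minimizer p r (B 0%N) ((B 1%N)^t* *m diag_part D *m B 1%N)))) => //.
have mp := @matrix_poly_cst R n p; have pr : real_poly (fun _ : nat -> M => r).
  exact: termfun_cst.
have mv := @matrix_poly_var R n.
have mdiag : matrix_poly (fun B : nat -> M => diag_part (B 2%N)).
  move=> k l; rewrite (_ : (fun _ => _) = if k == l then
      (fun B : nat -> M => B 2%N k k) else fun=> 0).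
    by case: ifP => _; [exact: mv|split; exact: termfun_cst].
  by apply/funext => B; rewrite !mxE; case: ifP.
apply: definable_and.
  exact: (matrix_definable_eq (matrix_polyM (mv 1%N) (matrix_poly_adj (mv 1%N)))
    (@matrix_poly_cst R n 1%:M)).
apply: definable_and; first exact: (matrix_definable_eqc (mv 2%N i i) (mv 2%N j j)).
by apply: (matrix_definable_minimizer (b := 3) mp pr (mv 0%N)
  (matrix_polyM (matrix_polyM (matrix_poly_adj (mv 1%N)) mdiag) (mv 1%N))).
Qed.

Definition is_local_minimizer (A N : M) :=
  local_minimizer_on normal_matrices (fun X => frobenius2 (A - X)) N.

Lemma local_minimizer_coordinate_finite (A : M) (i j : 'I_n) (f : C -> R) :
  f = @complex.Re R \/ f = @complex.Im R ->
  countable [set N | is_local_minimizer A N] ->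
  finite_set [set f (N i j) | N in [set N | is_local_minimizer A N]].
Proof.
move=> fE cL; pose k := (0 * dim + lshift (n * n) (mxvec_index i j))%N.
(* Real variables are encoded as entries of matrix variables: the radius of the
   box as the real part of an entry of [Y], the coordinate of [N] as the real
   part of an entry of the free variable. *)
pose P (B : nat -> M) := exists N : M, (exists Y : M,
  0 < complex.Re (Y i j) /\ box_minimizer N (complex.Re (Y i j)) A N) /\
  f (N i j) = complex.Re (B 0%N i j).
have PE : [set f (N i j) | N in [set N | is_local_minimizer A N]] =
    [set x | P (block n (set_nth 0 [::] k x))].
  apply/seteqP; split=> x /=.
    move=> [N /local_minimizer_boxP[r r0 mN] <-]; exists N; split.
      by exists (const_mx ((r%:C)%C : C)); rewrite mxE.
    by rewrite mxE /= tnth_mktuple nth_set_nth /= eqxx.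
  move=> [N [[Y [Y0 mN]] NE]]; exists N.
    by apply/local_minimizer_boxP; exists (complex.Re (Y i j)).
  by rewrite NE mxE /= tnth_mktuple nth_set_nth /= eqxx.
have cP : countable [set f (N i j) | N in [set N | is_local_minimizer A N]].
  exact: sub_countable (card_image_le _ _) cL.
rewrite PE in cP *; apply: (definable_countable_finite (P := fun e => P (block n e)) _ cP).
have mv := @matrix_poly_var R n; have mA := @matrix_poly_cst R n A.
apply: (@matrix_definable_exists R n 1 (fun B (N : M) => (exists Y : M,
  0 < complex.Re (Y i j) /\ box_minimizer N (complex.Re (Y i j)) A N) /\
  f (N i j) = complex.Re (B 0%N i j))) => //.
apply: definable_and.
  apply: (@matrix_definable_exists R n 2 (fun B (Y : M) => 0 < complex.Re (Y i j) /\
    box_minimizer (B 1%N) (complex.Re (Y i j)) A (B 1%N))) => //.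
  have [pr _] := mv 2%N i j.
  apply: definable_and; first exact: (definable_lt (termfun_cst 0) pr).
  by apply: (matrix_definable_minimizer (b := 3) (mv 1%N) pr mA (mv 1%N)).
apply: definable_eq; last by have [] := mv 0%N i j.
by have [pr pi] := mv 1%N i j; case: fE => ->.
Qed.

(** A matrix is determined by its real coordinates, each of which takes finitely
    many values. *)
Lemma local_minimizers_finite (A : M) :
  countable [set N | is_local_minimizer A N] ->
  finite_set [set N | is_local_minimizer A N].
Proof.
move=> cL; set L := [set N | _] in cL *.
pose F (ij : 'I_n * 'I_n) := [set complex.Re (N ij.1 ij.2) | N in L] `|`
                            [set complex.Im (N ij.1 ij.2) | N in L].
have finF : finite_set (\bigcup_ij F ij).
  apply: bigcup_finite => [|ij _]; first exact: finite_finset.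
  rewrite finite_setU; split.
    by apply: (@local_minimizer_coordinate_finite A ij.1 ij.2 (@complex.Re R)) => //; left.
  by apply: (@local_minimizer_coordinate_finite A ij.1 ij.2 (@complex.Im R)) => //; right.
pose S := fset_set (\bigcup_ij F ij).
have FS x ij : F ij x -> x \in S.
  by move=> Fx; rewrite in_fset_set//; apply/mem_set; exists ij.
pose G (h : {ffun 'I_n * 'I_n -> S * S}) : M :=
  \matrix_(i, j) (val (h (i, j)).1 +i* val (h (i, j)).2)%C.
apply: (@sub_finite_set _ _ (G @` setT)); last first.
  exact/finite_image/finite_finset.
move=> N LN.
have Re_S i j : complex.Re (N i j) \in S by apply: (FS _ (i, j)); left; exists N.
have Im_S i j : complex.Im (N i j) \in S by apply: (FS _ (i, j)); right; exists N.
exists [ffun ij => ([` Re_S ij.1 ij.2]%fset, [` Im_S ij.1 ij.2]%fset)] => //.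
by apply/matrixP => i j; rewrite mxE ffunE /=; case: (N i j).
Qed.

Definition rational_matrix (q : 'M[rat * rat]_n) : M :=
  \matrix_(i, j) (ratr (q i j).1 +i* ratr (q i j).2)%C.

(** A nearest point in a box is nearest in every smaller box containing it. *)
Lemma rational_box (A N : M) : is_local_minimizer A N ->
  exists q s, box_minimizer (rational_matrix q) (ratr s) A N.
Proof.
move=> /local_minimizer_boxP[r r0 [nN _ minN]].
have [s] := rat_in_itvoo (divr_gt0 r0 (ltr0n R 2)).
rewrite in_itv /= => /andP[s0 sr].
have approx (x : R) : exists q, `|x - ratr q| < ratr s.
  have [|q] := @rat_in_itvoo _ (x - ratr s) (x + ratr s); first lra.
  rewrite in_itv /= => /andP[q1 q2]; exists q; rewrite ltr_norml; lra.
have /choice[qq qqP] : forall ij : 'I_n * 'I_n, exists q : rat * rat,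
    `|complex.Re (N ij.1 ij.2) - ratr q.1| < ratr s /\
    `|complex.Im (N ij.1 ij.2) - ratr q.2| < ratr s.
  move=> ij; have [q1 h1] := approx (complex.Re (N ij.1 ij.2)).
  by have [q2 h2] := approx (complex.Im (N ij.1 ij.2)); exists (q1, q2).
pose q : 'M[rat * rat]_n := \matrix_(i, j) qq (i, j).
have Nq i j : complex.Re ((N - rational_matrix q) i j) =
    complex.Re (N i j) - ratr (qq (i, j)).1 /\
    complex.Im ((N - rational_matrix q) i j) =
    complex.Im (N i j) - ratr (qq (i, j)).2.
  by rewrite !mxE ReCD ImCD ReCN ImCN.
have bN : in_box (rational_matrix q) (ratr s) N.
  by move=> i j; have [-> ->] := Nq i j; exact: (qqP (i, j)).
exists q, s; split; [exact: nN|exact: bN|move=> X nX bX].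
apply: (minN X nX) => i j.
have := bX i j; have := bN i j.
rewrite !mxE !(ReCD, ImCD, ReCN, ImCN) !ltr_norml.
move=> [/andP[? ?] /andP[? ?]] [/andP[? ?] /andP[? ?]].
by split; lra.
Qed.

(** Each local minimizer is determined by a rational box in which it is the
    nearest point. *)
Lemma local_minimizers_countable (A : M) :
  (forall q s, ~ two_minimizers (rational_matrix q) (ratr s) A) ->
  countable [set N | is_local_minimizer A N].
Proof.
move=> uniqA.
pose G (qs : 'M[rat * rat]_n * rat) :=
  get [set N | box_minimizer (rational_matrix qs.1) (ratr qs.2) A N].
apply: (@sub_countable _ _ _ (G @` setT)).
  apply: subset_card_le => N /rational_box[q [s mN]]; exists (q, s) => //.
  have : box_minimizer (rational_matrix q) (ratr s) A (G (q, s)).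
    exact: (@getI _ [set N | box_minimizer _ _ A N] _ mN).
  move=> mG; apply: contrapT => GN; apply: (uniqA q s).
  by exists (G (q, s)), N.
exact: sub_countable (card_image_le _ _) (countableP _).
Qed.

Lemma distinct_eigenvalues (P : M) (d : 'rV[C]_n) : P \is unitarymx ->
  injective (d 0) -> has_distinct_eigenvalues (P^t* *m diag_mx d *m P).
Proof.
move=> uP injd; exists [tuple d 0 k | k < n]; split.
  by rewrite map_inj_uniq ?enum_uniq.
apply/allP => _ /mapP[k _ ->]; apply/eigenvalueP; exists (row k P).
  rewrite !mulmxA -row_mul (unitarymxP uP) row1 -rowE row_diag_mx -scalemxAl.
  by rewrite -rowE.
apply/eqP => Pk0; have : row k (P *m P^t*) = 0 by rewrite row_mul Pk0 mul0mx.
rewrite (unitarymxP uP) row1 => /rowP/(_ k).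
by rewrite !mxE !eqxx => /eqP; rewrite oner_eq0.
Qed.

End Generic.

Theorem corollary3p6 (R : realType) (n : nat) (n_gt0 : (0 < n)%N) :
  almost_every_matrix (fun A : 'M[Cfield R]_n =>
    let is_min :=
      local_minimizer_on normal_matrices (fun X => frobenius2 (A - X)) in
    finite_set [set N | is_min N] /\
    forall N0 : 'M[Cfield R]_n, is_min N0 ->
      has_distinct_eigenvalues N0 /\
      [set q : flag_manifold R n |
        local_minimizer (f_flag A) q /\ N_flag A q = N0] #= `I_(n`!)).
Proof.
rewrite /almost_every_matrix.
pose good (c : ('M[rat * rat]_n * rat) * ('I_n * 'I_n)) (A : 'M[Cfield R]_n) :=
  let p := rational_matrix R c.1.1 in let r := ratr c.1.2 in
  ~ two_minimizers p r A /\ (c.2.1 != c.2.2 ->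
  ~ exists Q d, repeated_minimizer p r c.2.1 c.2.2 A Q d).
have : {ae lebesgue_tuple R (n * n + n * n), forall t,
    forall c, good c (complex_matrix t)}.
  apply: ae_forall_countType => c; apply: filterI.
    have := @two_minimizers_negligible R n (rational_matrix R c.1.1) (ratr c.1.2).
    by apply: negligibleS => t /= /contrapT.
  have [cc|cc] := eqVneq c.2.1 c.2.2.
    apply: negligibleS (negligible_set0 _) => t /= bad.
    exact: bad.
  have := @repeated_minimizer_negligible R n (rational_matrix R c.1.1)
    (ratr c.1.2) _ _ cc.
  by apply: negligibleS => t /= bad; apply: contrapT => nbad; apply: bad.
apply: (@filterS _ _ (ae_filter_ringOfSetsType _)) => t; set A := complex_matrix t => goodA /=.
have i0 : 'I_n := Ordinal n_gt0.
split.
  apply/local_minimizers_finite/local_minimizers_countable => q s.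
  by have [] := goodA (q, s, (i0, i0)).
move=> N0 minN0; have [nN0 _] := minN0.
have /orthomx_spectral_subproof[[P d] /= uP N0E] := nN0.
rewrite invmx_unitary// in N0E.
have injd : injective (d 0).
  move=> i j dij; apply/eqP; apply: contrapT => /negP ij.
  have [q [s mN]] := rational_box minN0.
  have [_ /(_ ij)] := goodA (q, s, (i, j)); apply.
  rewrite N0E in mN.
  by exists P, d; split; [exact: uP|exact: dij|exact: mN].
split; first by rewrite N0E; exact: distinct_eigenvalues.
exact: (card_flag_fiber uP N0E injd minN0).
Qed.
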